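(* Let $(M^{2m},\varphi,g)$ be a para-Kähler-Norden manifold and $T^{\varphi}_{1}M$ its $\varphi$-unit tangent bundle equipped with the $\varphi$-Sasaki metric. If $\Gamma=(\gamma(t),\xi(t))$ is a horizontal lift of $\gamma$ and $\Gamma$ lies in $T^{\varphi}_{1}M$, then $\Gamma$ is a geodesic on $T^{\varphi}_{1}M$ if and only if $\gamma$ is a geodesic on $M$.
   Context: A para-Kähler-Norden manifold $(M^{2m},\varphi,g)$ is a $2m$-dimensional Riemannian manifold $(M,g)$ with a $(1,1)$-tensor field $\varphi$ such that $\varphi^2=\mathrm{id}$, $\varphi\ne\pm\mathrm{id}$, the $+1$ and $-1$ eigenbundles of $\varphi$ have equal rank, $g(\varphi X,Y)=g(X,\varphi Y)$, and $\nabla\varphi=0$, where $\nabla$ is the Levi-Civita connection of $g$. Points of $TM$ are written $(x,\xi)$; ${}^{H}X$, ${}^{V}X$ are the horizontal (with respect to $\nabla$) and vertical lifts to $TM$. The $\varphi$-Sasaki metric $g^\varphi$ on $TM$ is defined by $g^\varphi({}^HX,{}^HY)=g(X,Y)$, $g^\varphi({}^HX,{}^VY)=0$, $g^\varphi({}^VX,{}^VY)=g(X,\varphi Y)$. The $\varphi$-unit tangent bundle is the hypersurface $T^{\varphi}_{1}M=\{(x,\xi)\in TM: g(\xi,\varphi\xi)=1\}$, equipped with the metric induced by $g^\varphi$; $\widehat\nabla$ is the Levi-Civita connection of this induced metric. A curve $\Gamma=(\gamma(t),\xi(t))$ consists of a curve $\gamma$ on $M$ and a vector field $\xi$ along $\gamma$.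 Write $\gamma_t'=d\gamma/dt$, $\gamma_t''=\nabla_{\gamma_t'}\gamma_t'$, $\xi_t'=\nabla_{\gamma_t'}\xi$. $\Gamma$ is a horizontal lift of $\gamma$ if $\xi_t'=0$. $\Gamma$ is a geodesic on $T^\varphi_1M$ if $\widehat\nabla_{\Gamma_t'}\Gamma_t'=0$; $\gamma$ is a geodesic on $M$ if $\gamma_t''=0$. *)

(* Defs.v *)
From HB Require Import structures.
From mathcomp Require Import all_boot all_order all_algebra.
From mathcomp Require Import all_classical all_reals all_analysis.
From mathcomp Require Import ring lra.

Set Implicit Arguments.
Unset Strict Implicit.
Unset Printing Implicit Defensive.

Import Order.TTheory GRing.Theory Num.Theory.
Import numFieldNormedType.Exports.

Local Open Scope classical_set_scope.
Local Open Scope ring_scope.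

(* Vectors of R^n are row vectors, and linear maps act on them on the right:
   a (1,1)-tensor P sends u to u *m P, and the differential of f at x sends u
   to u *m jacobian f x. *)

Section Smoothness.
Context {R : realType} {V W : normedModType R}.

(* Only used with V finite dimensional and U open. *)
Fixpoint continuously_differentiable (k : nat) (U : set V) (f : V -> W) : Prop :=
  match k with
  | 0 => forall x, U x -> {for x, continuous f}
  | k'.+1 => (forall x, U x -> differentiable f x) /\
             (forall v, continuously_differentiable k' U ('D_v f))
  end.

Definition smooth (U : set V) (f : V -> W) : Prop :=
  forall k, continuously_differentiable k U f.

End Smoothness.

Section LeviCivita.
Context {R : realType} {n : nat}.
Implicit Types (H : 'M[R]_n) (h : 'rV[R]_n -> 'M[R]_n) (x u v w : 'rV[R]_n).

Definition bil H u v : R := (u *m H *m v^T) 0 0.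

(* Koszul formula for <nabla_u v, w> when u, v, w are constant fields. *)
Definition koszul h x u v w : R :=
  2^-1 * (bil ('d h x u) v w + bil ('d h x v) u w - bil ('d h x w) u v).

(* The vector Gamma(x)(u, v) with components Gamma^k_ij u^i v^j, where
   Gamma^k_ij are the Christoffel symbols of the (possibly indefinite)
   metric h; see [christoffelP]. *)
Definition christoffel h x u v : 'rV[R]_n :=
  (\row_k koszul h x u v (delta_mx 0 k)) *m invmx (h x).

(* Covariant derivatives for the Levi-Civita connection of h: of the field Y
   in the direction X, and of the field v along the curve c. *)
Definition covariant h (X Y : 'rV[R]_n -> 'rV[R]_n) x : 'rV[R]_n :=
  'D_(X x) Y x + christoffel h x (X x) (Y x).

Definition covariant_along h (c v : R -> 'rV[R]_n) (t : R) : 'rV[R]_n :=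
  derive1 v t + christoffel h (c t) (derive1 c t) (v t).

Definition acceleration h (c : R -> 'rV[R]_n) (t : R) : 'rV[R]_n :=
  covariant_along h c (derive1 c) t.

Lemma bilPl H a u u' v : bil H (a *: u + u') v = a * bil H u v + bil H u' v.
Proof. by rewrite /bil !mulmxDl -!scalemxAl !mxE. Qed.

Lemma bilPr H a u v v' : bil H u (a *: v + v') = a * bil H u v + bil H u v'.
Proof. by rewrite /bil linearP mulmxDr -scalemxAr !mxE. Qed.

Lemma bilPm H H' a u v : bil (a *: H + H') u v = a * bil H u v + bil H' u v.
Proof. by rewrite /bil mulmxDr mulmxDl -scalemxAr -scalemxAl !mxE. Qed.

Lemma bil_sym H u v : H^T = H -> bil H u v = bil H v u.
Proof.
move=> HT; rewrite /bil.
have -> : u *m H *m v^T = (v *m H *m u^T)^T.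
  by rewrite !trmx_mul trmxK HT mulmxA.
by rewrite mxE.
Qed.

Lemma koszulP h x u v a w w' :
  koszul h x u v (a *: w + w') = a * koszul h x u v w + koszul h x u v w'.
Proof. by rewrite /koszul linearP !bilPr bilPm; ring. Qed.

Lemma christoffelPl h x v a u u' :
  christoffel h x (a *: u + u') v =
  a *: christoffel h x u v + christoffel h x u' v.
Proof.
rewrite /christoffel scalemxAl -mulmxDl; congr (_ *m _).
by apply/rowP => k; rewrite !mxE /koszul linearP !bilPl bilPm; ring.
Qed.

Lemma bil_christoffel h x u v w : h x \in unitmx ->
  bil (h x) (christoffel h x u v) w = koszul h x u v w.
Proof.
move=> hU; rewrite /bil /christoffel mulmxKV // mxE.
pose f := koszul h x u v.
have f0 : f 0 = 0.
  have := koszulP h x u v (-1) 0 0.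
  by rewrite scaler0 addr0 mulN1r addNr.
have fD w1 w2 : f (w1 + w2) = f w1 + f w2.
  by have := koszulP h x u v 1 w1 w2; rewrite scale1r mul1r.
rewrite -/(f w) [in RHS](row_sum_delta w) (big_morph f fD f0).
apply: eq_bigr => k _; rewrite !mxE.
have := koszulP h x u v (w 0 k) (delta_mx 0 k) 0.
by rewrite addr0 -/(f 0) f0 addr0 -/(f _) mulrC => <-.
Qed.

Lemma bil_inj H u v : H \in unitmx -> (forall w, bil H u w = bil H v w) -> u = v.
Proof.
move=> HU E; rewrite -[u](mulmxK HU) -[v](mulmxK HU); congr (_ *m _).
apply/rowP => k; have := E (delta_mx 0 k).
have bk z : bil H z (delta_mx 0 k) = (z *m H) 0 k.
  rewrite /bil mxE (bigD1 k) //= big1 ?addr0 => [|j /negPf jk].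
    by rewrite !mxE !eqxx mulr1.
  by rewrite !mxE jk andbF mulr0.
by rewrite !bk.
Qed.

(* [christoffel] is the unique torsion-free connection compatible with h. *)
Lemma christoffelP h x (C : 'rV[R]_n -> 'rV[R]_n -> 'rV[R]_n) :
  h x \in unitmx -> (h x)^T = h x -> (forall u, ('d h x u)^T = 'd h x u) ->
  ((forall u v, C u v = C v u) /\
   (forall u v w, bil ('d h x u) v w =
                  bil (h x) (C u v) w + bil (h x) v (C u w)))
  <-> (forall u v, C u v = christoffel h x u v).
Proof.
move=> hU hT dT; have b u v := bil_sym u v hT; have db z u v := bil_sym u v (dT z).
split=> [[Csym Cmet] u v|E].
  apply: (bil_inj hU) => w; rewrite bil_christoffel // /koszul.
  rewrite (Cmet u v w) (Cmet v u w) (Cmet w u v).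
  rewrite (Csym v u) (Csym w u) (Csym w v).
  by rewrite (b v (C u w)) (b u (C v w)); field.
split=> [u v|u v w].
  apply: (bil_inj hU) => w; rewrite !E !bil_christoffel // /koszul.
  by rewrite (db w v u); ring.
rewrite !E (b v) !bil_christoffel // /koszul.
by rewrite (db u w v); field.
Qed.

End LeviCivita.

Section Manifold.
Context {R : realType}.

Record chart (n : nat) (T : Type) := Chart {
  dom : set T;
  cmap : T -> 'rV[R]_n;
  cinv : 'rV[R]_n -> T }.

Definition image_of n T (c : chart n T) : set 'rV[R]_n := cmap c @` dom c.

Record manifold (n : nat) := Manifold {
  point :> topologicalType;
  index : Type;
  atlas : index -> chart n point;
  manifold_hausdorff : hausdorff_space point;
  manifold_second_countable : @second_countable point;
  open_dom : forall i, open (dom (atlas i));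
  open_image : forall i, open (image_of (atlas i));
  cmapK : forall i p, dom (atlas i) p -> cinv (atlas i) (cmap (atlas i) p) = p;
  cmap_continuous : forall i p, dom (atlas i) p ->
    {for p, continuous (cmap (atlas i))};
  cinv_continuous : forall i x, image_of (atlas i) x ->
    {for x, continuous (cinv (atlas i))};
  atlas_cover : forall p, exists i, dom (atlas i) p;
  transition_smooth : forall i j,
    smooth (cmap (atlas i) @` (dom (atlas i) `&` dom (atlas j)))
           (cmap (atlas j) \o cinv (atlas i)) }.

End Manifold.

Section Geometry.
Context {R : realType} {n : nat} (M : manifold (R := R) n).
Implicit Types (i j : index M) (p : M).

Let U i : set M := dom (atlas i).
Let coord i : M -> 'rV[R]_n := cmap (atlas i).

Definition transition_jacobian i j p : 'M[R]_n :=
  jacobian (coord j \o cinv (atlas i)) (coord i p).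

(* A tangent vector at p is the family of its components in the charts around
   p; the last field makes the representation unique. *)
Record tangent (p : M) := Tangent {
  component : index M -> 'rV[R]_n;
  component_transition : forall i j, U i p -> U j p ->
    component j = component i *m transition_jacobian i j p;
  component_out : forall i, ~ U i p -> component i = 0 }.

Definition tangent_bundle : Type := {p : M & tangent p}.

(* Tensor fields are given by their components in each chart, as functions of
   the coordinates. *)
Definition tensor2 : Type := index M -> 'rV[R]_n -> 'M[R]_n.

Definition is_covariant2 (g : tensor2) : Prop :=
  (forall i, smooth (image_of (atlas i)) (g i)) /\
  (forall i j p, U i p -> U j p ->
     g i (coord i p) = transition_jacobian i j p *m g j (coord j p)
                         *m (transition_jacobian i j p)^T).

Definition is_endomorphism (phi : tensor2) : Prop :=
  (forall i, smooth (image_of (atlas i)) (phi i)) /\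
  (forall i j p, U i p -> U j p ->
     phi i (coord i p) *m transition_jacobian i j p =
     transition_jacobian i j p *m phi j (coord j p)).

Record riemannian (g : tensor2) : Prop := Riemannian {
  riemannian_tensor : is_covariant2 g;
  riemannian_sym : forall i x, image_of (atlas i) x -> (g i x)^T = g i x;
  riemannian_pos : forall i x, image_of (atlas i) x ->
    forall v, v != 0 -> 0 < bil (g i x) v v }.

(* (nabla_X phi) Y = nabla_X (phi Y) - phi (nabla_X Y) *)
Definition parallel_endomorphism (g phi : tensor2) : Prop :=
  forall i (X Y : 'rV[R]_n -> 'rV[R]_n),
    smooth (image_of (atlas i)) X -> smooth (image_of (atlas i)) Y ->
    forall x, image_of (atlas i) x ->
      covariant (g i) X (fun y => Y y *m phi i y) x
        - covariant (g i) X Y x *m phi i x = 0.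

Definition constant_endomorphism (phi : tensor2) (a : R) : Prop :=
  forall i x, image_of (atlas i) x -> phi i x = a%:M.

Section PhiUnitTangentBundle.
Variables g phi : tensor2.

Definition tangent_dom i : set tangent_bundle := [set z | U i (projT1 z)].

Definition tangent_coord i (z : tangent_bundle) : 'rV[R]_(n + n) :=
  row_mx (coord i (projT1 z)) (component (projT2 z) i).

Definition horizontal_lift i (z : 'rV[R]_(n + n)) (X : 'rV[R]_n)
    : 'rV[R]_(n + n) :=
  row_mx X (- christoffel (g i) (lsubmx z) X (rsubmx z)).

Definition vertical_lift (X : 'rV[R]_n) : 'rV[R]_(n + n) := row_mx 0 X.

(* Matrix taking natural coordinates of a vector tangent to the tangent bundle
   at z to its horizontal and vertical parts, see [lift_partsE]. *)
Definition lift_parts i (z : 'rV[R]_(n + n)) : 'M[R]_(n + n) :=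
  block_mx 1%:M
    (lin1_mx (fun X => christoffel (g i) (lsubmx z) X (rsubmx z)))
    0 1%:M.

(* The phi-Sasaki metric in natural coordinates, see [phi_sasakiE]. *)
Definition phi_sasaki i (z : 'rV[R]_(n + n)) : 'M[R]_(n + n) :=
  lift_parts i z
    *m block_mx (g i (lsubmx z)) 0
                0 (g i (lsubmx z) *m (phi i (lsubmx z))^T)
    *m (lift_parts i z)^T.

Lemma lift_partsE i z X Y :
  (horizontal_lift i z X + vertical_lift Y) *m lift_parts i z = row_mx X Y.
Proof.
pose f u := christoffel (g i) (lsubmx z) u (rsubmx z).
have fP : linear f by move=> a u v; exact: christoffelPl.
pose F : {linear 'rV[R]_n -> 'rV[R]_n} :=
  HB.pack f (GRing.isLinear.Build _ _ _ _ f fP).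
have E : X *m lin1_mx f = f X by rewrite -[lin1_mx f]/(lin1_mx F) mul_rV_lin1.
rewrite /horizontal_lift /vertical_lift /lift_parts add_row_mx addr0.
rewrite mul_row_block !mulmx1 mulmx0 addr0 E /f.
by rewrite addrA subrr add0r.
Qed.

Lemma phi_sasakiE i z X Y (x := lsubmx z) :
  [/\ bil (phi_sasaki i z) (horizontal_lift i z X) (horizontal_lift i z Y)
        = bil (g i x) X Y,
      bil (phi_sasaki i z) (horizontal_lift i z X) (vertical_lift Y) = 0,
      bil (phi_sasaki i z) (vertical_lift Y) (horizontal_lift i z X) = 0
    & bil (phi_sasaki i z) (vertical_lift X) (vertical_lift Y)
        = bil (g i x) X (Y *m phi i x)].
Proof.
have h0 : vertical_lift 0 = 0 by rewrite /vertical_lift row_mx0.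
have v0 : horizontal_lift i z 0 = 0.
  rewrite /horizontal_lift.
  have -> : christoffel (g i) (lsubmx z) 0 (rsubmx z) = 0.
    have := christoffelPl (g i) (lsubmx z) (rsubmx z) (-1) 0 0.
    by rewrite scaler0 addr0 scaleN1r addNr.
  by rewrite oppr0 row_mx0.
have H W : horizontal_lift i z W *m lift_parts i z = row_mx W 0.
  by rewrite -(lift_partsE i z W 0) h0 addr0.
have V W : vertical_lift W *m lift_parts i z = row_mx 0 W.
  by rewrite -(lift_partsE i z 0 W) v0 add0r.
have main a b : bil (phi_sasaki i z) a b =
    (a *m lift_parts i z
       *m block_mx (g i x) 0 0 (g i x *m (phi i x)^T)
       *m (b *m lift_parts i z)^T) 0 0.
  by rewrite /bil /phi_sasaki trmx_mul !mulmxA.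
rewrite !main !H !V !mul_row_block !mul0mx !mulmx0 !addr0 !add0r !tr_row_mx.
rewrite !trmx0 !mul_row_col !mul0mx !mulmx0 !addr0 !add0r /bil.
by split; rewrite ?trmx_mul ?mulmxA // mxE.
Qed.

Definition phi_unit_tangent_bundle : set tangent_bundle :=
  [set z | forall i, U i (projT1 z) ->
     let x := coord i (projT1 z) in let xi := component (projT2 z) i in
     bil (g i x) xi (xi *m phi i x) = 1].

End PhiUnitTangentBundle.

(* Curves are parametrized by an open interval J; values outside J are
   irrelevant. A vector field along gamma is a curve in the tangent bundle
   above gamma. *)
Definition lift_curve (gamma : R -> M) (xi : forall t, tangent (gamma t))
    : R -> tangent_bundle :=
  fun t => existT _ (gamma t) (xi t).

Definition smooth_field_along (J : set R) (gamma : R -> M)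
    (xi : forall t, tangent (gamma t)) : Prop :=
  (forall t, J t -> {for t, continuous gamma}) /\
  (forall i, smooth (J `&` [set t | U i (gamma t)])
                    (tangent_coord i \o lift_curve xi)).

Definition is_horizontal_lift (g : tensor2) (J : set R) (gamma : R -> M)
    (xi : forall t, tangent (gamma t)) : Prop :=
  forall t i, J t -> U i (gamma t) ->
    covariant_along (g i) (coord i \o gamma) (fun s => component (xi s) i) t = 0.

Definition is_geodesic (g : tensor2) (J : set R) (gamma : R -> M) : Prop :=
  forall t i, J t -> U i (gamma t) ->
    acceleration (g i) (coord i \o gamma) t = 0.

End Geometry.

Section Submanifold.
Context {R : realType} {d N : nat}.

(* psi is a diffeomorphism from the open set W of R^d onto the relatively open
   subset S `&` O of S, with inverse (the restriction to S of) chi. *)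
Record local_parametrization (S : set 'rV[R]_N)
    (W : set 'rV[R]_d) (psi : 'rV[R]_d -> 'rV[R]_N)
    (O : set 'rV[R]_N) (chi : 'rV[R]_N -> 'rV[R]_d) : Prop := {
  param_open : open W;
  param_open_image : open O;
  param_smooth : smooth W psi;
  param_inv_smooth : smooth O chi;
  param_image : psi @` W = S `&` O;
  paramK : forall w, W w -> chi (psi w) = w }.

Definition pullback (psi : 'rV[R]_d -> 'rV[R]_N) (h : 'rV[R]_N -> 'M[R]_N)
    (w : 'rV[R]_d) : 'M[R]_d :=
  jacobian psi w *m h (psi w) *m (jacobian psi w)^T.

End Submanifold.

Section Main.
Context {R : realType}.

Record para_kahler_norden (m : nat) (M : manifold (R := R) (2 * m))
    (phi g : tensor2 M) : Prop := {
  pkn_riemannian : riemannian g;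
  pkn_endomorphism : is_endomorphism phi;
  pkn_involution : forall i x, image_of (atlas i) x -> phi i x *m phi i x = 1%:M;
  pkn_neq_id : ~ constant_endomorphism phi 1;
  pkn_neq_opp_id : ~ constant_endomorphism phi (- 1);
  pkn_equal_rank : forall i x, image_of (atlas i) x ->
    \rank (eigenspace (phi i x) 1) = \rank (eigenspace (phi i x) (- 1));
  pkn_symmetric : forall i x, image_of (atlas i) x -> forall X Y,
    bil (g i x) (X *m phi i x) Y = bil (g i x) X (Y *m phi i x);
  pkn_parallel : parallel_endomorphism g phi }.

(* The curve Gamma, lying in the hypersurface T_1 of the tangent bundle, has
   zero acceleration for the Levi-Civita connection of the metric induced by
   the phi-Sasaki metric on T_1, in every local parametrization of T_1. *)
Definition is_geodesic_phi_unit n (M : manifold (R := R) n) (phi g : tensor2 M)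
    (J : set R) (Gamma : R -> tangent_bundle M) : Prop :=
  let T1 := phi_unit_tangent_bundle g phi in
  forall t i, J t -> tangent_dom i (Gamma t) ->
  forall (W : set 'rV[R]_(n + n).-1) psi O chi,
    local_parametrization (tangent_coord i @` (tangent_dom i `&` T1))
      W psi O chi ->
    O (tangent_coord i (Gamma t)) ->
    acceleration (pullback psi (phi_sasaki g phi i))
      (chi \o tangent_coord i \o Gamma) t = 0.

End Main.

(* Main.v *)
Require Import Defs.
From HB Require Import structures.
From mathcomp Require Import all_boot all_order all_algebra.
From mathcomp Require Import all_classical all_reals all_analysis.
From mathcomp Require Import perm ring lra.

Set Implicit Arguments.
Unset Strict Implicit.
Unset Printing Implicit Defensive.

Import Order.TTheory GRing.Theory Num.Theory.
Import numFieldNormedType.Exports.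

Local Open Scope classical_set_scope.
Local Open Scope ring_scope.

(* For a pseudo-Riemannian metric h, pairing the acceleration of a curve c with
   a vector e gives the Euler-Lagrange expression EL_h(c, e) of the kinetic
   energy, and Euler-Lagrange expressions are natural under pullback: if
   c = psi o w, then EL_(psi^* h)(w, e) = EL_h(c, d psi (e)). In the phi-Sasaki
   energy of a curve (x, y) in the tangent bundle the covariant derivative of y
   enters quadratically; hence if y is parallel then EL(c, (X, Y)) reduces to
   EL_g(x, X), without any computation of the Levi-Civita connection of the
   phi-Sasaki metric.

   Since nabla g = nabla phi = 0, the vertical lift of xi is half the gradient
   of the function g(xi, phi xi), and it has norm 1 on the level set 1. Thus the
   induced metric is nondegenerate and every horizontal vector is tangent to the
   hypersurface, so both geodesic equations say that EL_g(x, X) = 0 for all X. *)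

(** * Calculus of matrix-valued functions *)

Section MatrixCalculus.
Context {R : realType} {V : normedModType R}.
Implicit Types (x v : V).

Lemma is_derive_mxP m n (A : V -> 'M[R]_(m, n)) x v dA :
  is_derive x v A dA <->
  forall i j, is_derive x v (fun y => A y i j) (dA i j).
Proof.
split=> [[Ad AE] i j|Ad].
  split; first exact: (derivable_mxP _ _ _).1.
  by rewrite -AE derive_mx // mxE.
have Av : derivable A x v by apply/derivable_mxP => i j; exact: ex_derive.
split=> //; rewrite derive_mx //; apply/matrixP => i j; rewrite mxE.
exact: derive_val.
Qed.

Lemma is_derive_mulmx m n p (A : V -> 'M[R]_(m, n)) (B : V -> 'M[R]_(n, p))
    x v dA dB :
  is_derive x v A dA -> is_derive x v B dB ->
  is_derive x v (fun y => A y *m B y) (dA *m B x + A x *m dB).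
Proof.
move=> /is_derive_mxP Ad /is_derive_mxP Bd; apply/is_derive_mxP => i j.
pose F k y := A y i k * B y k j.
have Fd k : is_derive x v (F k) (dA i k * B x k j + A x i k * dB k j).
  have /is_derive_eq := is_deriveM (Ad i k) (Bd k j); apply.
  by rewrite /GRing.scale /=; ring.
have -> : (fun y => (A y *m B y) i j) = \sum_k F k.
  by apply/funext => y; rewrite mxE fct_sumE.
have /is_derive_eq := is_derive_sum Fd; apply.
by rewrite !mxE -big_split.
Qed.

Lemma is_derive_trmx m n (A : V -> 'M[R]_(m, n)) x v dA :
  is_derive x v A dA -> is_derive x v (fun y => (A y)^T) dA^T.
Proof.
move=> /is_derive_mxP Ad; apply/is_derive_mxP => i j.
by under eq_fun do rewrite mxE; rewrite mxE.
Qed.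

Lemma is_derive_bil n (H : V -> 'M[R]_n) (a b : V -> 'rV[R]_n) x v dH da db :
  is_derive x v H dH -> is_derive x v a da -> is_derive x v b db ->
  is_derive x v (fun y => bil (H y) (a y) (b y))
    (bil dH (a x) (b x) + bil (H x) da (b x) + bil (H x) (a x) db).
Proof.
move=> Hd ad bd.
have := is_derive_mulmx (is_derive_mulmx ad Hd) (is_derive_trmx bd).
move=> /is_derive_mxP/(_ 0 0)/is_derive_eq; apply.
by rewrite /bil mulmxDl !mxE; ring.
Qed.

Lemma differentiable_mxP m n (A : V -> 'M[R]_(m, n)) x :
  differentiable A x <->
  forall i j, differentiable (fun y => A y i j) x.
Proof.
split=> [Ad i j|Ad].
  exact: (differentiable_comp Ad (differentiable_coord _ i j)).
have -> : A = \sum_i \sum_j (fun y => A y i j *: delta_mx i j).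
  apply/funext => y; rewrite [LHS]matrix_sum_delta fct_sumE.
  by apply: eq_bigr => i _; rewrite fct_sumE.
apply: differentiable_sum => i; apply: differentiable_sum => j.
exact: differentiableZl.
Qed.

Lemma differentiable_mulmx m n p (A : V -> 'M[R]_(m, n))
    (B : V -> 'M[R]_(n, p)) x :
  differentiable A x -> differentiable B x ->
  differentiable (fun y => A y *m B y) x.
Proof.
move=> /differentiable_mxP Ad /differentiable_mxP Bd.
apply/differentiable_mxP => i j.
have -> : (fun y => (A y *m B y) i j) =
    \sum_k ((fun y => A y i k) * (fun y => B y k j)).
  by apply/funext => y; rewrite mxE fct_sumE.
by apply: differentiable_sum => k; exact: differentiableM.
Qed.

Lemma differentiable_trmx m n (A : V -> 'M[R]_(m, n)) x :
  differentiable A x -> differentiable (fun y => (A y)^T) x.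
Proof.
move=> /differentiable_mxP Ad; apply/differentiable_mxP => i j.
by under eq_fun do rewrite mxE.
Qed.

Lemma differentiable_bil n (H : V -> 'M[R]_n) (a b : V -> 'rV[R]_n) x :
  differentiable H x -> differentiable a x -> differentiable b x ->
  differentiable (fun y => bil (H y) (a y) (b y)) x.
Proof.
move=> Hd ad bd.
have /differentiable_mxP := differentiable_mulmx (differentiable_mulmx ad Hd)
  (differentiable_trmx bd).
exact.
Qed.

Lemma differentiable_det n (A : V -> 'M[R]_n) x :
  differentiable A x -> differentiable (fun y => \det (A y)) x.
Proof.
move=> /differentiable_mxP Ad.
have -> : (fun y => \det (A y)) =
    \sum_(s : 'S_n) ((-1) ^+ s *: \prod_i (fun y => A y i (s i))).
  apply/funext => y; rewrite fct_sumE /determinant; apply: eq_bigr => s _.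
  by rewrite fct_prodE.
elim/big_ind : _ => [|f g|s _]; first exact: differentiable_cst.
  exact: differentiableD.
apply: differentiableZ; elim/big_ind : _ => [|f g|i _].
- exact: (differentiable_cst (1 : R)).
- exact: differentiableM.
- exact: Ad.
Qed.

Lemma near_eq_differentiable (W : normedModType R) (f g : V -> W) x :
  (\forall y \near x, f y = g y) -> differentiable f x -> differentiable g x.
Proof.
move=> fg df; have fgx := nbhs_singleton fg.
have gE : g \o shift x = cst (g x) + 'd f x +o_ 0 id.
  apply/eqaddoP => e e0; have /eqaddoP/(_ e e0) := diff_locally df.
  move: fg; rewrite (near_shift 0) subr0; apply: filterS2 => y /= fgy.
  by rewrite !fctE /= fgy fgx.
have dE := diff_unique (diff_continuous df) gE.
apply/diff_locallyP; rewrite dE; split=> //; exact: diff_continuous.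
Qed.

(** Cramer's rule. [invmx] returns its argument on singular matrices, so the adjugate formula is
    available only where [A y] is invertible. *)
Lemma differentiable_invmx n (A : V -> 'M[R]_n) x :
  differentiable A x -> (\forall y \near x, A y \in unitmx) ->
  differentiable (fun y => invmx (A y)) x.
Proof.
move=> Ad Au; apply/differentiable_mxP => i j.
have : differentiable
    ((fun y => (\det (A y))^-1) * (fun y => cofactor (A y) j i)) x.
  apply: differentiableM.
    apply: differentiableV; first exact: differentiable_det.
    by rewrite -unitfE -unitmxE (nbhs_singleton Au).
  apply: differentiableZ; apply: differentiable_det.
  apply/differentiable_mxP => k l; under eq_fun do rewrite !mxE.
  by move/differentiable_mxP : Ad; apply.
apply: near_eq_differentiable; apply: filterS Au => y Auy.
by rewrite /invmx Auy !mxE.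
Qed.

End MatrixCalculus.

(** * Derivatives along curves and lines, and Schwarz's theorem *)

Section DerivativeTools.
Context {R : realType} {V : normedModType R}.
Implicit Types (x v u w : V).

Lemma is_derive_diff (W : normedModType R) (f : V -> W) x v :
  differentiable f x -> is_derive x v f ('d f x v).
Proof. by move=> df; split; [exact: diff_derivable|exact: deriveE]. Qed.

Lemma is_derive_curve_comp (W : normedModType R) (c : R -> V) (h : V -> W)
    (t : R) dc :
  is_derive t 1 c dc -> differentiable h (c t) ->
  is_derive t 1 (h \o c) ('d h (c t) dc).
Proof.
move=> [cd cE] hd; have {}cd : differentiable c t by exact/derivable1_diffP.
split; first exact/derivable1_diffP/differentiable_comp.
rewrite deriveE; last exact: differentiable_comp.
by rewrite diff_comp //= -cE deriveE.
Qed.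

Lemma is_derive_line x v (r : R) : is_derive r 1 (fun r => r *: v + x) v.
Proof.
have d : is_diff r (fun r => r *: v + x) ( *:%R^~ v + 0).
  exact: (is_diffD (is_diff_scalel r v) (is_diff_cst x r)).
split; first exact/derivable1_diffP.
by rewrite deriveE // diff_val fctE scale1r addr0.
Qed.

Lemma is_derive_along_line (W : normedModType R) (h : V -> W) x v (r : R) :
  differentiable h (r *: v + x) ->
  is_derive r 1 (fun r => h (r *: v + x)) ('D_v h (r *: v + x)).
Proof.
move=> hd; rewrite deriveE //.
exact: (is_derive_curve_comp (is_derive_line x v r)).
Qed.

(** The mean value theorem is applied twice: along [u] to the increment of [f] by [s *: v], then
    along [v] to ['D_u f]. *)
Lemma second_difference (f : V -> R) (U : set V) u v w (s : R) : 0 < s ->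
  (forall a b, 0 <= a <= s -> 0 <= b <= s -> U (a *: u + b *: v + w)) ->
  (forall x, U x -> differentiable f x) ->
  (forall x, U x -> differentiable ('D_u f) x) ->
  exists a b, [/\ 0 <= a <= s, 0 <= b <= s &
    f (s *: u + s *: v + w) - f (s *: u + w) - (f (s *: v + w) - f w) =
    'D_v ('D_u f) (a *: u + b *: v + w) * s * s].
Proof.
move=> s0 sU df ddf.
have ss : 0 <= s <= s by rewrite lexx ltW.
have s00 : 0 <= (0 : R) <= s by rewrite lexx ltW.
have mvt (F dF : R -> R) :
    (forall r, 0 <= r <= s -> is_derive r 1 F (dF r)) ->
    exists2 r, 0 <= r <= s & F s - F 0 = dF r * s.
  move=> dFP; have [||r] := @MVT _ F dF 0 s s0.
  - move=> r; rewrite in_itv /= => /andP[r0 rs]; apply: dFP.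
    by rewrite !ltW.
  - apply: derivable_within_continuous => r; rewrite in_itv /= => rs.
    by have [] := dFP r rs.
  - rewrite in_itv /= subr0 => /andP[r0 rs] E; exists r => //.
    by rewrite !ltW.
have [|a ha] := mvt (fun r => f (r *: u + (s *: v + w)) - f (r *: u + w))
  (fun r => 'D_u f (r *: u + (s *: v + w)) - 'D_u f (r *: u + w)).
  move=> r rs.
  have U1 := sU _ _ rs ss; have U2 := sU _ _ rs s00.
  rewrite -addrA in U1; rewrite scale0r addr0 in U2.
  have d1 := is_derive_along_line (df _ U1).
  have d2 := is_derive_along_line (df _ U2).
  exact: (is_deriveB d1 d2).
have [|b hb] := mvt (fun r => 'D_u f (r *: v + (a *: u + w)))
  (fun r => 'D_v ('D_u f) (r *: v + (a *: u + w))).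
  move=> r rs; apply: is_derive_along_line; apply: ddf.
  by rewrite addrCA addrA; exact: sU.
have line0 d y : 0 *: d + y = y :> V by rewrite scale0r add0r.
rewrite (line0 u (s *: v + w)) (line0 u w) (line0 v (a *: u + w)) => E2 E1.
exists a, b; split => //.
have pE c d : c *: u + d *: v + w = d *: v + (c *: u + w).
  by rewrite addrCA addrA.
rewrite (pE a b) -E2 -(addrA (s *: u)) (addrCA (s *: v)); exact: E1.
Qed.
Lemma near_parallelogram (P : V -> Prop) u v w : (\forall x \near w, P x) ->
  exists2 s : R, 0 < s & forall a b, 0 <= a <= s -> 0 <= b <= s ->
    P (a *: u + b *: v + w).
Proof.
move=> /nbhs_ballP[r /= r0 rP]; pose K := `|u| + `|v| + 1.
have K0 : 0 < K by rewrite ltr_wpDl // addr_ge0.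
(* [K] is positive and exceeds [|u| + |v|], so combinations with coefficients at most [r / K / 2]
   have norm below [r]. *)
exists (r / K / 2); first by rewrite !divr_gt0.
move=> a b /andP[a0 ha] /andP[b0 hb]; apply: rP; rewrite -ball_normE /=.
rewrite opprD addrCA subrr addr0 normrN.
rewrite (le_lt_trans (ler_normD _ _)) // !normrZ !ger0_norm //.
rewrite (@le_lt_trans _ _ (r / K / 2 * (`|u| + `|v|))) //.
  by rewrite mulrDr lerD // ler_wpM2r.
rewrite -[ltRHS](divfK (lt0r_neq0 K0)) -[ltLHS]mulrA ltr_pM2l ?divr_gt0 //.
rewrite ltr_pdivrMl // /K.
by have := normr_ge0 u; have := normr_ge0 v; lra.
Qed.

(** Suited to the mean value theorem, which equates [F] and [G] only at two different, uncontrolled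
    points near [w]. If the limits differed, staying within half their distance would keep such
    values apart. *)
Lemma eq_common_limit (F G : V -> R) w :
  {for w, continuous F} -> {for w, continuous G} ->
  (forall P : V -> Prop, (\forall x \near w, P x) ->
     exists x y, [/\ P x, P y & F x = G y]) -> F w = G w.
Proof.
move=> Fc Gc FG; apply/eqP; rewrite -subr_eq0 -normr_le0 leNgt; apply/negP.
set e := `|_| => e0; have e20 : 0 < e / 2 by rewrite divr_gt0.
have [|x [y [[Fx _] [_ Gy] E]]] :=
    FG (fun x => `|F w - F x| < e / 2 /\ `|G w - G x| < e / 2).
  move/cvgrPdist_lt/(_ _ e20) in Fc; move/cvgrPdist_lt/(_ _ e20) in Gc.
  by near=> x; split; near: x.
move: Fx Gy; rewrite E /e ![`|_ - G y| < _]ltr_norml.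
move=> /andP[h1 h2] /andP[h3 h4]; have := lexx `|F w - G w|.
by apply/negP; rewrite -ltNge ltr_norml; apply/andP; split; lra.
Unshelve. all: by end_near. Qed.

(** The second difference over a small parallelogram is symmetric in [u] and [v], and it is [s * s]
    times either mixed derivative at some point there; by continuity both points may shrink to
    [w]. *)
Lemma second_derivative_sym_scalar (f : V -> R) (U : set V) u v w :
  open U -> U w -> continuously_differentiable 2 U f ->
  'D_v ('D_u f) w = 'D_u ('D_v f) w.
Proof.
move=> oU Uw [df ddf].
have d2 z x : U x -> differentiable ('D_z f) x := (ddf z).1 x.
have cont a b : {for w, continuous ('D_a ('D_b f))} := (ddf b).2 a w Uw.
apply: (eq_common_limit (cont v u) (cont u v)) => P Pw.
have wUP : \forall x \near w, (U x /\ P x).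
  by apply: filterI => //; exact: (open_nbhs_nbhs (conj oU Uw)).
have [s s0 sP] := near_parallelogram u v wUP.
have [|a [b [ha hb E1]]] := @second_difference f U u v w s s0 _ df (d2 u).
  by move=> a b ha hb; have [] := sP a b ha hb.
have [|b' [a' [hb' ha' E2]]] := @second_difference f U v u w s s0 _ df (d2 v).
  move=> b' a' hb' ha'; rewrite (addrC (b' *: _)).
  by have [] := sP a' b' ha' hb'.
exists (a *: u + b *: v + w), (b' *: v + a' *: u + w); split.
- by have [] := sP a b ha hb.
- by rewrite (addrC (b' *: _)); have [] := sP a' b' ha' hb'.
apply: (mulIf (lt0r_neq0 s0)); apply: (mulIf (lt0r_neq0 s0)).
refine (etrans (esym E1) (etrans _ E2)); rewrite (addrC (s *: u)).
by move: (f _) (f _) (f _) (f _) => *; ring.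
Qed.

End DerivativeTools.

(** * Closure properties of functions of class C^k on an open set *)

Section ContinuouslyDifferentiable.
Context {R : realType} {V : normedModType R}.
Implicit Types (U : set V) (k : nat).

Lemma near_open U x (P : V -> Prop) : open U -> U x ->
  (forall y, U y -> P y) -> \forall y \near x, P y.
Proof. by move=> oU Ux UP; apply: filterS UP _; exact: open_nbhs_nbhs. Qed.

Lemma near_eq_continuous (W : normedModType R) (f g : V -> W) x :
  (\forall y \near x, f y = g y) -> {for x, continuous f} ->
  {for x, continuous g}.
Proof.
move=> fg fc; rewrite /prop_for /continuous_at -(nbhs_singleton fg).
exact: cvg_trans (near_eq_cvg fg) fc.
Qed.

(** Openness turns equality on [U] into equality near each point, which derivatives respect. The
    inductions below use this to replace a derivative by the formula that computes it. *)
Lemma cd_eq (W : normedModType R) k U (f g : V -> W) : open U ->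
  (forall x, U x -> f x = g x) ->
  continuously_differentiable k U f -> continuously_differentiable k U g.
Proof.
move=> oU; elim: k f g => [|k IH] f g fg /=.
  by move=> fc x Ux; apply: near_eq_continuous (fc x Ux); exact: near_open fg.
move=> [df cdf]; split=> [x Ux|v].
  by apply: near_eq_differentiable (df x Ux); exact: near_open fg.
apply: IH (cdf v) => x Ux; apply: near_eq_derive; exact: near_open fg.
Qed.

Lemma cdW (W : normedModType R) k U (f : V -> W) :
  continuously_differentiable k.+1 U f -> continuously_differentiable k U f.
Proof.
elim: k f => [|k IH] f [df cdf]; last by split=> // v; exact: IH.
by move=> x Ux; apply: differentiable_continuous; exact: df.
Qed.

Lemma cd_sub (W : normedModType R) k U U' (f : V -> W) : U' `<=` U ->
  continuously_differentiable k U f -> continuously_differentiable k U' f.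
Proof.
move=> UU'; elim: k f => [|k IH] f /=.
  by move=> fc x /UU'; exact: fc.
by move=> [df cdf]; split=> [x /UU'|v]; [exact: df|exact: IH].
Qed.

Lemma cd_cst (W : normedModType R) k U (w : W) :
  continuously_differentiable k U (cst w).
Proof.
elim: k w => [|k IH] w /=; first by move=> x _; exact: cst_continuous.
split=> [x _|v]; first exact: differentiable_cst.
suff -> : 'D_v (cst w) = cst (0 : W) :> (V -> W) by [].
by apply/funext => x; rewrite derive_cst.
Qed.

Lemma cdD (W : normedModType R) k U (f g : V -> W) : open U ->
  continuously_differentiable k U f -> continuously_differentiable k U g ->
  continuously_differentiable k U (f + g).
Proof.
move=> oU; elim: k f g => [|k IH] f g /=.
  by move=> fc gc x Ux; apply: continuousD; [exact: fc|exact: gc].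
move=> [df cdf] [dg cdg]; split=> [x Ux|v].
  by apply: differentiableD; [exact: df|exact: dg].
apply: cd_eq (IH _ _ (cdf v) (cdg v)) => // x Ux.
by rewrite deriveD //; apply: diff_derivable; [exact: df|exact: dg].
Qed.

Lemma cd_sum (W : normedModType R) k U (I : Type) (r : seq I)
    (f : I -> V -> W) : open U ->
  (forall i, continuously_differentiable k U (f i)) ->
  continuously_differentiable k U (\sum_(i <- r) f i).
Proof.
move=> oU fcd; elim/big_ind : _ => //; first exact: cd_cst.
by move=> ? ?; exact: cdD.
Qed.

Lemma cdM k U (f g : V -> R) : open U ->
  continuously_differentiable k U f -> continuously_differentiable k U g ->
  continuously_differentiable k U (f * g).
Proof.
move=> oU; elim: k f g => [|k IH] f g.
  by move=> fc gc x Ux; apply: continuousM; [exact: fc|exact: gc].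
move=> fcd gcd; have fcd' := cdW fcd; have gcd' := cdW gcd.
case: fcd gcd => [df cdf] [dg cdg]; split=> [x Ux|v].
  by apply: differentiableM; [exact: df|exact: dg].
apply: cd_eq (cdD oU (IH _ _ fcd' (cdg v)) (IH _ _ gcd' (cdf v))) => // x Ux.
by rewrite deriveM //; apply: diff_derivable; [exact: df|exact: dg].
Qed.

Lemma cd_linear_comp (W W' : normedModType R) (L : {linear W -> W'}) k U
    (f : V -> W) :
  open U -> continuous L ->
  continuously_differentiable k U f ->
  continuously_differentiable k U (L \o f).
Proof.
move=> oU Lc; elim: k f => [|k IH] f /=.
  by move=> fc x Ux; apply: continuous_comp; [exact: fc|exact: Lc].
have Ld x := linear_differentiable x Lc.
move=> [df cdf]; split=> [x Ux|v].
  by apply: differentiable_comp; [exact: df|exact: Ld].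
apply: cd_eq (IH _ (cdf v)) => // x Ux; have dfx := df x Ux.
rewrite deriveE; last exact: differentiable_comp.
by rewrite diff_comp // diff_lin //= deriveE.
Qed.

(** The derivative is [- 'D_v f] times the square of the reciprocal itself, so the induction closes.
    Smoothness of [f] is assumed in all orders so that the hypothesis does not vary with [k]. *)
Lemma cdV k U (f : V -> R) : open U -> (forall x, U x -> f x != 0) ->
  smooth U f -> continuously_differentiable k U (fun x => (f x)^-1).
Proof.
move=> oU f0 fs; have [df _] := fs 1; elim: k => [|k IH].
  move=> x Ux; apply: differentiable_continuous.
  by apply: differentiableV; [exact: df|exact: f0].
split=> [x Ux|v].
  by apply: differentiableV; [exact: df|exact: f0].
have fk := (fs k.+1).2 v.
have := cdM oU (cdM oU (cd_cst k U (-1 : R)) fk) (cdM oU IH IH).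
apply: cd_eq => // x Ux.
rewrite deriveV ?f0 //; last by apply: diff_derivable; exact: df.
by rewrite /GRing.scale /= !fctE expr2 invfM; ring.
Qed.

(** The derivative is [- 2^-1 * 'D_v f] times the cube of the function itself, so the induction
    closes as for the reciprocal. *)
Lemma cd_inv_sqrt k U (f : V -> R) : open U -> (forall x, U x -> 0 < f x) ->
  smooth U f -> continuously_differentiable k U (fun x => (Num.sqrt (f x))^-1).
Proof.
move=> oU f0 fs; have [df _] := fs 1.
have dsqrt x : U x -> differentiable (fun y => Num.sqrt (f y)) x.
  move=> Ux; apply: (differentiable_comp (df x Ux)).
  by apply/derivable1_diffP; have [] := is_derive1_sqrt (f0 x Ux).
have sqrt0 x : U x -> Num.sqrt (f x) != 0.
  by move=> Ux; rewrite gt_eqF // sqrtr_gt0 f0.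
elim: k => [|k IH].
  move=> x Ux; apply: differentiable_continuous.
  by apply: differentiableV; [exact: dsqrt|exact: sqrt0].
split=> [x Ux|v].
  by apply: differentiableV; [exact: dsqrt|exact: sqrt0].
have fk := (fs k.+1).2 v.
have := cdM oU (cdM oU (cd_cst k U (- 2^-1 : R)) fk) (cdM oU IH (cdM oU IH IH)).
apply: cd_eq => // x Ux.
have ds := diff_derivable (v := v) (dsqrt x Ux).
rewrite deriveV ?sqrt0 // !fctE.
(* Obtained by differentiating the square of the root, which equals [f] near [x] because [f] is
   positive on [U]. *)
have -> : 'D_v f x = 2 * Num.sqrt (f x) * 'D_v (fun y => Num.sqrt (f y)) x.
  have E : \forall y \near x,
      f y = ((fun y => Num.sqrt (f y)) * (fun y => Num.sqrt (f y))) y.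
    apply: (near_open oU Ux) => y Uy.
    by rewrite fctE -expr2 sqr_sqrtr // ltW ?f0.
  by rewrite (near_eq_derive _ E) deriveM // /GRing.scale /=; ring.
rewrite /GRing.scale /=.
by field; exact: sqrt0.
Qed.

Lemma linear_mx_continuous m n (W : normedModType R)
  (L : {linear 'M[R]_(m, n) -> W}) : continuous L.
Proof.
have -> : (L : _ -> _) =
    \sum_i \sum_j (fun A : 'M[R]_(m, n) => A i j *: L (delta_mx i j)).
  apply/funext => A; rewrite [in LHS](matrix_sum_delta A) linear_sum fct_sumE.
  apply: eq_bigr => i _; rewrite linear_sum fct_sumE; apply: eq_bigr => j _.
  by rewrite linearZ.
move=> A; apply: differentiable_continuous.
apply: differentiable_sum => i; apply: differentiable_sum => j.
by apply: differentiableZl; exact: differentiable_coord.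
Qed.

Lemma cd_mxP m n k U (A : V -> 'M[R]_(m, n)) : open U ->
  continuously_differentiable k U A <->
  forall i j, continuously_differentiable k U (fun x => A x i j).
Proof.
move=> oU; split=> [Acd i j|Acd].
  pose c (B : 'M[R]_(m, n)) : R := B i j.
  have cP : linear c by move=> a B C; rewrite /c !mxE.
  pose C : {linear 'M[R]_(m, n) -> R} :=
    HB.pack c (GRing.isLinear.Build _ _ _ _ c cP).
  exact: (@cd_linear_comp _ _ C _ _ _ oU (@linear_mx_continuous _ _ _ C) Acd).
have -> : A = \sum_i \sum_j (fun y => A y i j *: delta_mx i j).
  apply/funext => y; rewrite [LHS]matrix_sum_delta fct_sumE.
  by apply: eq_bigr => i _; rewrite fct_sumE.
apply: cd_sum => // i; apply: cd_sum => // j.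
pose c (a : R) : 'M[R]_(m, n) := a *: delta_mx i j.
have cP : linear c by move=> a x y; rewrite /c scalerDl scalerA.
pose C : {linear R -> 'M[R]_(m, n)} :=
  HB.pack c (GRing.isLinear.Build _ _ _ _ c cP).
have Cc : continuous C by exact: scalel_continuous.
exact: (@cd_linear_comp _ _ C _ _ _ oU Cc (Acd i j)).
Qed.

Lemma cd_mulmx m n p k U (A : V -> 'M[R]_(m, n)) (B : V -> 'M[R]_(n, p)) :
  open U -> continuously_differentiable k U A ->
  continuously_differentiable k U B ->
  continuously_differentiable k U (fun x => A x *m B x).
Proof.
move=> oU /(cd_mxP _ _ oU) Acd /(cd_mxP _ _ oU) Bcd.
apply/(cd_mxP _ _ oU) => i j.
have -> : (fun y => (A y *m B y) i j) =
    \sum_l ((fun y => A y i l) * (fun y => B y l j)).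
  by apply/funext => y; rewrite mxE fct_sumE.
by apply: cd_sum => // l; exact: cdM.
Qed.

Lemma cd_trmx m n k U (A : V -> 'M[R]_(m, n)) : open U ->
  continuously_differentiable k U A ->
  continuously_differentiable k U (fun x => (A x)^T).
Proof.
move=> oU /(cd_mxP _ _ oU) Acd; apply/(cd_mxP _ _ oU) => i j.
by under eq_fun do rewrite mxE.
Qed.

Lemma cd_id k U : continuously_differentiable k U (id : V -> V).
Proof.
case: k => [|k] /=; first by move=> x _; exact: cvg_id.
split=> [x _|v]; first exact: ex_diff.

suff -> : 'D_v (id : V -> V) = cst v by exact: cd_cst.
by apply/funext => x; rewrite derive_id.
Qed.

Lemma cd_linear (W : normedModType R) k U (L : {linear V -> W}) :
  open U -> continuous L -> continuously_differentiable k U L.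
Proof. by move=> oU Lc; exact: (cd_linear_comp oU Lc (cd_id k U)). Qed.

Lemma cd_scale m n k U (s : V -> R) (A : V -> 'M[R]_(m, n)) : open U ->
  continuously_differentiable k U s -> continuously_differentiable k U A ->
  continuously_differentiable k U (fun x => s x *: A x).
Proof.
move=> oU scd /(cd_mxP _ _ oU) Acd; apply/(cd_mxP _ _ oU) => i j.
under eq_fun do rewrite mxE.
exact: (cdM oU scd (Acd i j)).
Qed.

Lemma cd_row_mx m n1 n2 k U (A : V -> 'M[R]_(m, n1)) (B : V -> 'M[R]_(m, n2)) :
  open U -> continuously_differentiable k U A ->
  continuously_differentiable k U B ->
  continuously_differentiable k U (fun x => row_mx (A x) (B x)).
Proof.
move=> oU /(cd_mxP _ _ oU) Acd /(cd_mxP _ _ oU) Bcd.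
apply/(cd_mxP _ _ oU) => i j; under eq_fun do rewrite mxE.
by case: (fintype.split j).
Qed.

Lemma cd_bil n k U (H : V -> 'M[R]_n) (a b : V -> 'rV[R]_n) : open U ->
  continuously_differentiable k U H -> continuously_differentiable k U a ->
  continuously_differentiable k U b ->
  continuously_differentiable k U (fun x => bil (H x) (a x) (b x)).
Proof.
move=> oU Hcd acd bcd.
exact: (cd_mxP _ _ oU).1
  (cd_mulmx oU (cd_mulmx oU acd Hcd) (cd_trmx oU bcd)) 0 0.
Qed.

End ContinuouslyDifferentiable.
(** The derivative of the composite along [v] is ['D_(L v) f] composed with the same affine map, so
    the induction on [k] keeps its form. *)
Lemma cd_affine_comp (R : realType) (V V' W : normedModType R)
    (L : {linear V' -> V}) (b : V) k (U : set V) (f : V -> W) :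
  open U -> continuous L ->
  continuously_differentiable k U f ->
  continuously_differentiable k [set x | U (L x + b)] (fun x => f (L x + b)).
Proof.
move=> oU Lc.
have Ad x : differentiable (fun y => L y + b) x.
  apply: differentiableD; last exact: differentiable_cst.
  exact: linear_differentiable.
have AE x : 'd (fun y => L y + b) x = L :> (V' -> V).
  rewrite (diffD (linear_differentiable x Lc) (differentiable_cst b x)).
  apply/funext => y; rewrite -[LHS]/('d L x y + 'd (cst b) x y).
  by rewrite (diff_lin x Lc) (diff_cst b x); exact: addr0.
have Ac : continuous (fun y => L y + b).
  by move=> x; exact: differentiable_continuous.
have oLU : open [set x | U (L x + b)] by apply: open_comp => // x _; exact: Ac.
elim: k f => [|k IH] f /=.
  move=> fc x Ux; apply: (continuous_comp (Ac x)); exact: fc.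
move=> [df cdf]; split=> [x Ux|v].
  exact: (differentiable_comp (Ad x) (df _ Ux)).
have := IH _ (cdf (L v)); apply: (cd_eq oLU) => x Ux.
have dfx := df _ Ux.
rewrite (deriveE v (differentiable_comp (Ad x) dfx)).
by rewrite diff_comp //= AE deriveE.
Qed.

Lemma second_derivative_sym (R : realType) (V : normedModType R) n
    (f : V -> 'rV[R]_n) (U : set V) u v w :
  open U -> U w -> continuously_differentiable 2 U f ->
  'D_v ('D_u f) w = 'D_u ('D_v f) w.
Proof.
move=> oU Uw cf; have [df ddf] := cf.
have coordD (g : V -> 'rV[R]_n) x z k : differentiable g x ->
    'D_z g x 0 k = 'D_z (fun y => g y 0 k) x.
  by move=> gd; rewrite derive_mx ?mxE //; exact: diff_derivable.
have near_coord z k : \forall x \near w,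
    'D_z f x 0 k = 'D_z (fun y => f y 0 k) x.
  apply: (near_open oU Uw) => x Ux; exact: coordD (df x Ux).
have coordDD a b k :
    'D_b ('D_a f) w 0 k = 'D_b ('D_a (fun y => f y 0 k)) w.
  refine (etrans (coordD _ _ b k ((ddf a).1 w Uw)) _).
  exact: near_eq_derive (near_coord a k).
apply/rowP => k.
refine (etrans (coordDD u v k) (etrans _ (esym (coordDD v u k)))).
apply: (second_derivative_sym_scalar u v oU Uw).
exact: (cd_mxP _ _ oU).1 cf 0 k.
Qed.

(** * Euler-Lagrange equations *)

Section EulerLagrange.
Context {R : realType}.

Lemma is_derive_unique (V W : normedModType R) (f : V -> W) x v a b :
  is_derive x v f a -> is_derive x v f b -> a = b.
Proof. by move=> [_ <-] [_ <-]. Qed.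

Lemma is_derive1 (W : normedModType R) (f : R -> W) t :
  derivable f t 1 -> is_derive t 1 f (derive1 f t).
Proof. by rewrite derive1E; exact: derivableP. Qed.

Lemma is_derive_near_eq (V W : normedModType R) (f g : V -> W) x v a b :
  (\forall y \near x, f y = g y) ->
  is_derive x v f a -> is_derive x v g b -> a = b.
Proof. by move=> fg /(near_eq_is_derive fg); exact: is_derive_unique. Qed.

(* The Lagrangian is the kinetic energy [2^-1 * bil (h x) u u]. *)
Definition euler_lagrange n (h : 'rV[R]_n -> 'M[R]_n) (c : R -> 'rV[R]_n)
    (t : R) (e : 'rV[R]_n) : R :=
  bil (h (c t)) (derive1 (derive1 c) t) e
  + bil ('d h (c t) (derive1 c t)) (derive1 c t) e
  - 2^-1 * bil ('d h (c t) e) (derive1 c t) (derive1 c t).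

Lemma bilDl n (H : 'M[R]_n) u u' v : bil H (u + u') v = bil H u v + bil H u' v.
Proof. by rewrite -[u]scale1r bilPl mul1r scale1r. Qed.

Lemma bil0l n (H : 'M[R]_n) v : bil H 0 v = 0.
Proof. by rewrite /bil !mul0mx mxE. Qed.

Lemma bil0r n (H : 'M[R]_n) v : bil H v 0 = 0.
Proof. by rewrite /bil trmx0 mulmx0 mxE. Qed.

(** With both arguments equal to the velocity, the first two Koszul terms coincide. *)
Lemma bil_acceleration n (h : 'rV[R]_n -> 'M[R]_n) (c : R -> 'rV[R]_n) t e :
  h (c t) \in unitmx ->
  bil (h (c t)) (acceleration h c t) e = euler_lagrange h c t e.
Proof.
move=> hU; rewrite /acceleration /covariant_along bilDl bil_christoffel //.
by rewrite /koszul /euler_lagrange; field.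
Qed.

Lemma acceleration_eq0P n (h : 'rV[R]_n -> 'M[R]_n) (c : R -> 'rV[R]_n) t :
  h (c t) \in unitmx ->
  acceleration h c t = 0 <-> forall e, euler_lagrange h c t e = 0.
Proof.
move=> hU; split=> [a0 e|el0]; first by rewrite -bil_acceleration // a0 bil0l.
by apply: (bil_inj hU) => e; rewrite bil_acceleration // el0 bil0l.
Qed.

(** The first two Euler-Lagrange terms are the derivative of the momentum. With [is_derive_kinetic]
    for the third, two such expressions can be compared by differentiating functions that agree
    nearby. *)
Lemma is_derive_momentum n (h : 'rV[R]_n -> 'M[R]_n) (c : R -> 'rV[R]_n) t e :
  differentiable h (c t) -> derivable c t 1 -> derivable (derive1 c) t 1 ->
  is_derive t 1 (fun s => bil (h (c s)) (derive1 c s) e)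
    (bil (h (c t)) (derive1 (derive1 c) t) e
     + bil ('d h (c t) (derive1 c t)) (derive1 c t) e).
Proof.
move=> hd /is_derive1 cd /is_derive1 c'd.
have := is_derive_bil (is_derive_curve_comp cd hd) c'd (is_derive_cst e t 1).
by move=> /is_derive_eq; apply; rewrite bil0r addr0 addrC.
Qed.

(** The velocity [u] is frozen while the position moves along a line in the direction [e]. *)
Lemma is_derive_kinetic n (h : 'rV[R]_n -> 'M[R]_n) z e u :
  differentiable h z ->
  is_derive (0 : R) 1 (fun r => bil (h (r *: e + z)) u u)
    (bil ('d h z e) u u).
Proof.
move=> hd; have z0 : 0 *: e + z = z by rewrite scale0r add0r.
have hd0 : differentiable h (0 *: e + z) by rewrite z0.
have cu := is_derive_cst u (0 : R) (1 : R).
have := is_derive_bil (is_derive_curve_comp (is_derive_line z e 0) hd0) cu cu.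
by move=> /is_derive_eq; apply; rewrite bil0r bil0l !addr0 z0.
Qed.

Lemma differentiable_jacobian d N (psi : 'rV[R]_d -> 'rV[R]_N) W y :
  open W -> W y -> continuously_differentiable 2 W psi ->
  differentiable (jacobian psi) y.
Proof.
move=> oW Wy [dpsi cpsi]; apply/differentiable_mxP => i j.
have : differentiable (fun x => 'D_(delta_mx 0 i) psi x 0 j) y.
  exact: (differentiable_mxP _ _).1 ((cpsi _).1 y Wy) 0 j.
apply: near_eq_differentiable; apply: (near_open oW Wy) => x Wx.
by rewrite deriveE ?mxE //; exact: dpsi.
Qed.

Lemma bil_pullback d N (psi : 'rV[R]_d -> 'rV[R]_N) (h : 'rV[R]_N -> 'M[R]_N)
    w u v :
  bil (pullback psi h w) u v =
  bil (h (psi w)) (u *m jacobian psi w) (v *m jacobian psi w).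
Proof. by rewrite /bil /pullback trmx_mul !mulmxA. Qed.

(** The variation of the differential of [psi] adds a second derivative of [psi] to the momentum
    term and to the kinetic term; by Schwarz's theorem the two contributions cancel. *)
Lemma euler_lagrange_pullback d N (psi : 'rV[R]_d -> 'rV[R]_N)
    (h : 'rV[R]_N -> 'M[R]_N) (W : set 'rV[R]_d) (w : R -> 'rV[R]_d)
    (c : R -> 'rV[R]_N) t e :
  open W -> continuously_differentiable 2 W psi ->
  (\forall s \near t, [/\ W (w s), c s = psi (w s) & derivable w s 1]) ->
  derivable (derive1 w) t 1 ->
  differentiable h (c t) -> (h (c t))^T = h (c t) ->
  euler_lagrange (pullback psi h) w t e =
  euler_lagrange h c t (e *m jacobian psi (w t)).
Proof.
move=> oW psi2 wP w'd hd hT; have [dpsi cpsi] := psi2.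
have [Wt ct wd] := nbhs_singleton wP.
have psid : differentiable psi (w t) := dpsi _ Wt.
have DE v y : W y -> 'D_v psi y = v *m jacobian psi y.
  by move=> Wy; rewrite deriveEjacobian //; exact: dpsi.
have Jd := differentiable_jacobian oW Wt psi2.
have hpsid : differentiable (h \o psi) (w t).
  by apply: differentiable_comp => //; rewrite -ct.
have kd : differentiable (pullback psi h) (w t).
  apply: differentiable_mulmx (differentiable_trmx Jd).
  exact: differentiable_mulmx.
(* Needed near [t] and not only at [t], since this relation is differentiated once more. *)
have c'E : \forall s \near t, derive1 c s = derive1 w s *m jacobian psi (w s).
  apply: filterS (near_join wP) => s sP.
  have [Ws cs /is_derive1 wsd] := nbhs_singleton sP.
  have dc := is_derive_curve_comp wsd (dpsi _ Ws).
  rewrite derive1E; have : \forall r \near s, c r = (psi \o w) r.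
    by apply: filterS sP => r [].
  move=> /near_eq_derive ->; rewrite [LHS](derive_val (is_derive := dc)).
  exact: etrans (esym (deriveE _ (dpsi _ Ws))) (DE _ _ Ws).
have c't := nbhs_singleton c'E.
have /is_derive1 w1 := wd; have /is_derive1 w2 := w'd.
have cd : derivable c t 1.
  have [dd _] := is_derive_curve_comp w1 psid.
  by apply: near_eq_derivable dd; apply: filterS wP => s [].
have c'd : derivable (derive1 c) t 1.
  have [dd _] := is_derive_mulmx w2 (is_derive_curve_comp w1 Jd).
  by apply: near_eq_derivable dd; apply: filterS c'E.
have Dd v : differentiable ('D_v psi) (w t) := (cpsi v).1 _ Wt.
pose E := e *m jacobian psi (w t); pose u := derive1 w t.
have EE : 'd psi (w t) e = E.
  exact: etrans (esym (deriveE _ psid)) (DE _ _ Wt).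
have hpsid' : differentiable h (psi (w t)) by rewrite -ct.
have hpsiE : 'd (h \o psi) (w t) e = 'd h (c t) E.
  have /(congr1 (fun F => F e)) := diff_comp psid hpsid'.
  by rewrite ct -EE.
have uE : 'D_u psi (w t) = derive1 c t by rewrite c't; exact: DE.
(* The momentum of [w] against the fixed [e] is that of [c] against the moving vector
   ['D_e psi (w s)], whose derivative gives the extra last term. *)
have momentum :
    bil (pullback psi h (w t)) (derive1 (derive1 w) t) e
      + bil ('d (pullback psi h) (w t) u) u e =
    bil (h (c t)) (derive1 (derive1 c) t) E
      + bil ('d h (c t) (derive1 c t)) (derive1 c t) E
      + bil (h (c t)) (derive1 c t) ('D_u ('D_e psi) (w t)).
  have d1 := is_derive_momentum e kd wd w'd.
  have /is_derive1 dc := cd; have /is_derive1 dc' := c'd.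
  have d2 := is_derive_bil (is_derive_curve_comp dc hd) dc'
    (is_derive_curve_comp w1 (Dd e)).
  apply: etrans (is_derive_near_eq _ d1 d2) _; last first.
    by rewrite /= DE // -/E deriveE //; ring.
  apply: filterS2 wP c'E => s [Ws cs _] c's.
  by rewrite /= bil_pullback cs c's DE.
(* Here [u] is fixed but its image ['D_u psi] moves with the point; it occupies both slots, whence
   the factor 2. *)
have kinetic : bil ('d (pullback psi h) (w t) e) u u =
    bil ('d h (c t) E) (derive1 c t) (derive1 c t)
      + 2 * bil (h (c t)) (derive1 c t) ('D_e ('D_u psi) (w t)).
  have z0 : 0 *: e + w t = w t by rewrite scale0r add0r.
  have d1 := is_derive_kinetic e u kd.
  have line := is_derive_line (w t) e 0.
  have psid0 : differentiable (h \o psi) (0 *: e + w t) by rewrite z0.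
  have Dd0 : differentiable ('D_u psi) (0 *: e + w t) by rewrite z0.
  have D1 := is_derive_curve_comp line Dd0.
  have d2 := is_derive_bil (is_derive_curve_comp line psid0) D1 D1.
  apply: etrans (is_derive_near_eq _ d1 d2) _; last first.
    rewrite /= z0 hpsiE uE -(deriveE e (Dd u)) -ct.
    rewrite (bil_sym _ (derive1 c t) hT).
    by move: (bil _ _ _) (bil _ _ _) => *; ring.
  have lineW : \forall r \near (0 : R), W (r *: e + w t).
    have := differentiable_continuous
      ((derivable1_diffP _ _).1 (ex_derive (is_derive := line))).
    by apply; rewrite /= z0; exact: open_nbhs_nbhs.
  apply: filterS lineW => r Wr.
  by rewrite /= bil_pullback DE.
rewrite /euler_lagrange momentum kinetic.
rewrite (second_derivative_sym u e oW Wt psi2) -/E.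
by move: (bil _ _ _) (bil _ _ _) (bil _ _ _) (bil _ _ _) => *; field.
Qed.

End EulerLagrange.

(** * The phi-Sasaki metric *)

(** [V] is a unit normal to the row space of [J], a hyperplane. As [V] is not orthogonal to itself
    it lies outside this hyperplane, and the two span everything; definiteness of [G] is not
    assumed. *)
Lemma hypersurface_nondegenerate (R : realType) N
    (G : 'M[R]_N) (J : 'M[R]_(N.-1, N))
    (V : 'rV[R]_N) :
  G \in unitmx -> G^T = G -> row_free J ->
  (forall e, bil G V (e *m J) = 0) -> bil G V V = 1 ->
  J *m G *m J^T \in unitmx /\ (forall a, bil G V a = 0 -> exists e, a = e *m J).
Proof.
move=> GU GT Jfree VJ VV.
have full : row_full (J + V)%MS.
  have : (\rank J < \rank (J + V)%MS)%N.
    apply: rank_ltmx; rewrite ltmxE addsmxSl /=.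
    apply/negP => /(submx_trans (addsmxSr J V)) /submxP[e VE].
    by have := VJ e; rewrite -VE VV => /eqP; rewrite oner_eq0.
  rewrite (eqP Jfree) /row_full eqn_leq rank_leq_col.
  (* The rank exceeds [N.-1], and [N <= N.-1.+1] holds even for [N = 0]. *)
  exact: leq_trans (leqSpred N).
have decomp a : exists e k, a = e *m J + k *: V.
  have /sub_addsmxP[[e k] /= ->] := submx_full a full.
  by exists e, (k 0 0); rewrite [k in LHS]mx11_scalar mul_scalar_mx.
split=> [|a Va].
  rewrite -row_free_unit -kermx_eq0; apply/rowV0P => e /sub_kermxP eJ0.
  (* This vector is orthogonal to the rows of [J] and to [V], hence to everything. *)
  have eJ : e *m J = 0.
    apply: (bil_inj GU) => b; have [f [k ->]] := decomp b.
    rewrite addrC bilPr (bil_sym _ _ GT) VJ mulr0 add0r /bil trmx_mul.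
    by rewrite !mulmxA in eJ0 *; rewrite eJ0 !mul0mx !mxE.
  by apply: (row_free_inj Jfree); rewrite eJ mul0mx.
(* The coefficient of [V] in [a] is [bil G V a], which vanishes. *)
have [e [k aE]] := decomp a; exists e.
move: Va; rewrite aE addrC bilPr VV VJ mulr1 addr0 => ->.
by rewrite scale0r add0r.
Qed.

Section PhiSasaki.
Context {R : realType} {n : nat} (M : manifold (R := R) n) (phi g : tensor2 M).
Context (i : Defs.index M).
Let D : set 'rV[R]_n := image_of (atlas i).
Context (g_smooth : smooth D (g i)) (phi_smooth : smooth D (phi i)).
Context (g_sym : forall x, D x -> (g i x)^T = g i x).
Context (g_pos : forall x, D x -> forall v, v != 0 -> 0 < bil (g i x) v v).
Context (phi_inv : forall x, D x -> phi i x *m phi i x = 1%:M).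
Context (phi_sym : forall x, D x -> forall X Y,
  bil (g i x) (X *m phi i x) Y = bil (g i x) X (Y *m phi i x)).
Context (phi_parallel : forall X Y : 'rV[R]_n -> 'rV[R]_n,
  smooth D X -> smooth D Y -> forall x, D x ->
  covariant (g i) X (fun y => Y y *m phi i y) x
  - covariant (g i) X Y x *m phi i x = 0).
Implicit Types (x u v : 'rV[R]_n) (z a b : 'rV[R]_(n + n)).

Let oD : open D. Proof. exact: open_image. Qed.

Let g_diff x : D x -> differentiable (g i) x.
Proof. by move=> Dx; exact: (g_smooth 1).1. Qed.

Let phi_diff x : D x -> differentiable (phi i) x.
Proof. by move=> Dx; exact: (phi_smooth 1).1. Qed.

Let g_unit x : D x -> g i x \in unitmx.
Proof.
move=> Dx; rewrite -row_free_unit -kermx_eq0; apply/rowV0P => v.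
move=> /sub_kermxP vg; apply/eqP; apply/negP => /negP v0.
by have := g_pos Dx v0; rewrite /bil vg mul0mx mxE ltxx.
Qed.

Definition fiber_metric x : 'M[R]_n := g i x *m (phi i x)^T.

Lemma bil_fiber_metric x u v :
  bil (fiber_metric x) u v = bil (g i x) u (v *m phi i x).
Proof. by rewrite /bil /fiber_metric trmx_mul !mulmxA. Qed.

Lemma bil_delta d (H : 'M[R]_d) k l :
  bil H (delta_mx 0 k) (delta_mx 0 l) = H k l.
Proof. by rewrite /bil -rowE trmx_delta -colE !mxE. Qed.

Lemma fiber_metric_sym x : D x -> (fiber_metric x)^T = fiber_metric x.
Proof.
move=> Dx; apply/matrixP => k l; rewrite mxE -!bil_delta !bil_fiber_metric.
by rewrite -phi_sym // bil_sym // g_sym.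
Qed.

Lemma fiber_metric_unit x : D x -> fiber_metric x \in unitmx.
Proof.
move=> Dx; rewrite unitmx_mul g_unit // unitmx_tr.
by have [] := mulmx1_unit (phi_inv Dx).
Qed.

(** The connection map: on the velocity of a curve [(x, y)] in the tangent bundle it gives the
    covariant derivative of [y] along [x]. *)
Definition vertical_part z a : 'rV[R]_n :=
  rsubmx a + christoffel (g i) (lsubmx z) (lsubmx a) (rsubmx z).

Lemma mul_lift_parts z a :
  a *m lift_parts g i z = row_mx (lsubmx a) (vertical_part z a).
Proof.
rewrite -(lift_partsE g i z); congr (_ *m _).
rewrite /horizontal_lift /vertical_lift /vertical_part add_row_mx addr0.
by rewrite addrCA addNr addr0 hsubmxK.
Qed.

Lemma bil_phi_sasaki z a b :
  bil (phi_sasaki g phi i z) a b =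
  bil (g i (lsubmx z)) (lsubmx a) (lsubmx b)
  + bil (fiber_metric (lsubmx z)) (vertical_part z a) (vertical_part z b).
Proof.
have -> : bil (phi_sasaki g phi i z) a b =
    (a *m lift_parts g i z *m block_mx (g i (lsubmx z)) 0 0
       (fiber_metric (lsubmx z)) *m (b *m lift_parts g i z)^T) 0 0.
  by rewrite /bil /phi_sasaki trmx_mul !mulmxA.
rewrite !mul_lift_parts mul_row_block !mulmx0 addr0 add0r tr_row_mx.
by rewrite mul_row_col mxE.
Qed.

Lemma phi_sasaki_sym z : D (lsubmx z) ->
  (phi_sasaki g phi i z)^T = phi_sasaki g phi i z.
Proof.
move=> Dz; apply/matrixP => k l; rewrite mxE -!bil_delta !bil_phi_sasaki.
by congr (_ + _); rewrite bil_sym // ?g_sym // fiber_metric_sym.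
Qed.

Lemma phi_sasaki_unit z : D (lsubmx z) -> phi_sasaki g phi i z \in unitmx.
Proof.
move=> Dz.
have LU : lift_parts g i z \in unitmx.
  by rewrite unitmxE /lift_parts det_ublock !det1 mulr1 unitr1.
rewrite /phi_sasaki !unitmx_mul unitmx_tr LU /= andbT.
by rewrite unitmxE det_ublock unitrM -!unitmxE g_unit ?fiber_metric_unit.
Qed.

(** One Koszul term differentiates the metric in the moving direction [rsubmx y]. Expanding it in
    the standard basis leaves derivatives in fixed directions, to which smoothness of [g]
    applies. *)
Lemma differentiable_christoffel u z : D (lsubmx z) ->
  differentiable (fun y : 'rV[R]_(n + n) =>
    christoffel (g i) (lsubmx y) u (rsubmx y)) z.
Proof.
move=> Dz; have ld := differentiable_lsubmx z.
have rd := differentiable_rsubmx z.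
have nearD : \forall y \near z, D (lsubmx y).
  apply: (differentiable_continuous ld); exact: open_nbhs_nbhs.
have dg v : differentiable (fun y => 'D_v (g i) (lsubmx y)) z.
  exact: (differentiable_comp ld (((g_smooth 2).2 v).1 _ Dz)).
apply: differentiable_mulmx; last first.
  apply: differentiable_invmx.
    exact: (differentiable_comp ld (g_diff Dz)).
  by apply: filterS nearD => y; exact: g_unit.
apply/differentiable_mxP => k0 k; pose e : 'rV[R]_n := delta_mx 0 k.
have cd w : differentiable (fun _ : 'rV[R]_(n + n) => w) z.
  exact: differentiable_cst.
pose F (y : 'rV[R]_(n + n)) : R :=
  bil ('D_u (g i) (lsubmx y)) (rsubmx y) e
  + \sum_j rsubmx y 0 j * bil ('D_(delta_mx 0 j) (g i) (lsubmx y)) u e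
  - bil ('D_e (g i) (lsubmx y)) u (rsubmx y).
have Fd : differentiable F z.
  apply: differentiableB; last exact: differentiable_bil.
  apply: differentiableD; first exact: differentiable_bil.
  have -> : (fun y : 'rV[R]_(n + n) => \sum_j rsubmx y 0 j *
        bil ('D_(delta_mx 0 j) (g i) (lsubmx y)) u e) =
      \sum_j ((fun y : 'rV[R]_(n + n) => rsubmx y 0 j) *
        (fun y => bil ('D_(delta_mx 0 j) (g i) (lsubmx y)) u e)).
    by apply/funext => y; rewrite fct_sumE.
  apply: differentiable_sum => j; apply: differentiableM.
    exact: (differentiable_mxP _ _).1 rd 0 j.
  exact: differentiable_bil.
have := differentiableZ 2^-1 Fd.
apply: near_eq_differentiable; apply: filterS nearD => y Dy.
rewrite !fctE mxE /koszul /F; congr (_ * (_ + _ - _)).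
- by rewrite deriveE //; exact: g_diff.
- rewrite [in RHS](row_sum_delta (rsubmx y)) linear_sum /bil.
  rewrite mulmx_sumr mulmx_suml summxE; apply: eq_bigr => j _.
  rewrite linearZ -scalemxAr -scalemxAl [in RHS]mxE deriveE //; exact: g_diff.
- by rewrite deriveE //; exact: g_diff.
Qed.

Lemma differentiable_vertical_part a z : D (lsubmx z) ->
  differentiable (fun y => vertical_part y a) z.
Proof.
move=> Dz; apply: (@differentiableD _ _ _ (cst (rsubmx a))).
  exact: differentiable_cst.
exact: differentiable_christoffel.
Qed.

Lemma differentiable_fiber_metric x : D x -> differentiable fiber_metric x.
Proof.
move=> Dx; apply: differentiable_mulmx; first exact: g_diff.
by apply: differentiable_trmx; exact: phi_diff.
Qed.

Lemma differentiable_phi_sasaki z : D (lsubmx z) ->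
  differentiable (phi_sasaki g phi i) z.
Proof.
move=> Dz; apply/differentiable_mxP => k l; have ld := differentiable_lsubmx z.
under eq_fun do rewrite -bil_delta bil_phi_sasaki.
apply: differentiableD; apply: differentiable_bil.
- exact: (differentiable_comp ld (g_diff Dz)).
- exact: differentiable_cst.
- exact: differentiable_cst.
- exact: (differentiable_comp ld (differentiable_fiber_metric Dz)).
- exact: differentiable_vertical_part.
- exact: differentiable_vertical_part.
Qed.

(** [christoffelP] is applied to [christoffel] itself; the differential of [g] is symmetric because
    [g] is symmetric on the open set [D]. *)
Lemma metric_compatibility x u v w : D x ->
  bil ('d (g i) x u) v w =
  bil (g i x) (christoffel (g i) x u v) w
  + bil (g i x) v (christoffel (g i) x u w).
Proof.
move=> Dx; have dT y : ('d (g i) x y)^T = 'd (g i) x y.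
  have d := is_derive_diff y (g_diff Dx).
  by apply: is_derive_near_eq (is_derive_trmx d) d; exact: (near_open oD Dx).
have [_ gP] := christoffelP (christoffel (g i) x) (g_unit Dx) (g_sym Dx) dT.
exact: (gP (fun _ _ => erefl)).2.
Qed.

(** Parallelism of [phi] tested on constant fields, where only Christoffel terms and the
    differential of [phi] survive. *)
Lemma phi_parallel_const x u v : D x ->
  v *m 'd (phi i) x u =
  christoffel (g i) x u v *m phi i x - christoffel (g i) x u (v *m phi i x).
Proof.
move=> Dx.
have cs w : smooth D (cst w : 'rV[R]_n -> 'rV[R]_n) by move=> k; exact: cd_cst.
have := phi_parallel (cs u) (cs v) Dx; rewrite /covariant derive_cst add0r.
have dv := is_derive_mulmx (is_derive_cst v x u)
  (is_derive_diff u (phi_diff Dx)).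
rewrite [X in X + _ - _](derive_val (is_derive := dv)) mul0mx add0r.
by move=> /subr0_eq <-; rewrite addrK.
Qed.

(** The fibre metric is parallel because [g] and [phi] are. The terms with
    [christoffel (g i) x u (v *m phi i x)] cancel, and the other two agree by symmetry of [phi]. *)
Lemma fiber_metric_compatibility x u v : D x ->
  bil ('d fiber_metric x u) v v =
  2 * bil (fiber_metric x) v (christoffel (g i) x u v).
Proof.
move=> Dx.
have dK := is_derive_mulmx (is_derive_diff u (g_diff Dx))
  (is_derive_trmx (is_derive_diff u (phi_diff Dx))).
have -> := is_derive_unique
  (is_derive_diff u (differentiable_fiber_metric Dx)) dK.
have -> : bil ('d (g i) x u *m (phi i x)^T + g i x *m ('d (phi i) x u)^T) v v =
    bil ('d (g i) x u) v (v *m phi i x) + bil (g i x) v (v *m 'd (phi i) x u).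
  by rewrite /bil mulmxDr mulmxDl mxE !trmx_mul !mulmxA.
rewrite phi_parallel_const // metric_compatibility // bil_fiber_metric.
rewrite (bil_sym (christoffel (g i) x u v)) ?g_sym // phi_sym //.
have -> p q : bil (g i x) v (p - q) = bil (g i x) v p - bil (g i x) v q.
  by rewrite addrC -scaleN1r bilPr mulN1r addrC.
ring.
Qed.

(** This is g(xi, phi xi) in natural coordinates; its level 1 is the phi-unit tangent bundle seen in
    the chart. *)
Definition fiber_energy z : R :=
  bil (fiber_metric (lsubmx z)) (rsubmx z) (rsubmx z).

Lemma diff_lsubmx (z a : 'rV[R]_(n + n)) :
  'd (lsubmx : 'rV[R]_(n + n) -> 'rV[R]_n) z a = lsubmx a.
Proof.
by rewrite (diff_lin z (@linear_mx_continuous _ _ _ _ (@lsubmx R 1 n n))).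
Qed.

Lemma diff_rsubmx (z a : 'rV[R]_(n + n)) :
  'd (rsubmx : 'rV[R]_(n + n) -> 'rV[R]_n) z a = rsubmx a.
Proof.
by rewrite (diff_lin z (@linear_mx_continuous _ _ _ _ (@rsubmx R 1 n n))).
Qed.

Lemma vertical_part_vertical_lift z u : vertical_part z (vertical_lift u) = u.
Proof.
rewrite /vertical_part row_mxKl row_mxKr.
have := christoffelPl (g i) (lsubmx z) (rsubmx z) (-1) 0 0.
by rewrite scaler0 addr0 scaleN1r addNr => ->; rewrite addr0.
Qed.

(* The vertical lift of the position vector is half the gradient of the fibre
   energy, hence normal to the hypersurface where this energy equals 1. *)
Lemma diff_fiber_energy z a : D (lsubmx z) ->
  is_derive z a fiber_energy
    (2 * bil (phi_sasaki g phi i z) (vertical_lift (rsubmx z)) a).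
Proof.
move=> Dz; have ld := differentiable_lsubmx z.
have rd := differentiable_rsubmx z.
have Kd := differentiable_comp ld (differentiable_fiber_metric Dz).
have yd := is_derive_diff a rd.
have := is_derive_bil (is_derive_diff a Kd) yd yd.
move=> /is_derive_eq; apply.
have -> : 'd (fiber_metric \o lsubmx) z a =
    'd fiber_metric (lsubmx z) (lsubmx a).
  have /(congr1 (fun F => F a)) :=
    diff_comp ld (differentiable_fiber_metric Dz).
  by rewrite /= diff_lsubmx.
(* The base variation contributes a Christoffel term and the fibre variation [rsubmx a]; together
   they make up [vertical_part z a]. *)
rewrite /= diff_rsubmx fiber_metric_compatibility // bil_phi_sasaki.
rewrite vertical_part_vertical_lift row_mxKl bil0l add0r /vertical_part.
rewrite (bil_sym (rsubmx a)) ?fiber_metric_sym //.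
have -> u v w : bil (fiber_metric (lsubmx z)) u (v + w) =
    bil (fiber_metric (lsubmx z)) u v + bil (fiber_metric (lsubmx z)) u w.
  by rewrite -[v]scale1r bilPr mul1r scale1r.
ring.
Qed.

(* The vertical velocity enters the energy quadratically, so it contributes
   nothing to the Euler-Lagrange equation of a curve along which it vanishes. *)
Lemma euler_lagrange_phi_sasaki (c : R -> 'rV[R]_(n + n)) t e :
  (\forall s \near t, derivable c s 1) -> derivable (derive1 c) t 1 ->
  D (lsubmx (c t)) ->
  (\forall s \near t, vertical_part (c s) (derive1 c s) = 0) ->
  euler_lagrange (phi_sasaki g phi i) c t e =
  euler_lagrange (g i) (fun s => lsubmx (c s)) t (lsubmx e).
Proof.
move=> cd c'd Dct cH; have ct := nbhs_singleton cd.
have lE (f : R -> 'rV[R]_(n + n)) s : derivable f s 1 ->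
    is_derive s 1 (fun s => lsubmx (f s)) (lsubmx (derive1 f s)).
  move=> /is_derive1 fd.
  have := is_derive_curve_comp fd (differentiable_lsubmx (f s)).
  by rewrite diff_lsubmx.
pose x s := lsubmx (c s).
have x'E : \forall s \near t, derive1 x s = lsubmx (derive1 c s).
  apply: filterS cd => s /lE [_ <-]; exact: derive1E.
have xd : derivable x t 1 by have [] := lE _ _ ct.
have x'd : derivable (derive1 x) t 1.
  have [dd _] := lE _ _ c'd; apply: near_eq_derivable dd.
  by apply: filterS x'E => s /esym.
have Gd := differentiable_phi_sasaki Dct.
have gd := g_diff Dct.
have x't := nbhs_singleton x'E; have cHt := nbhs_singleton cH.
pose u := derive1 c t.
have momentum :
    bil (phi_sasaki g phi i (c t)) (derive1 (derive1 c) t) e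
      + bil ('d (phi_sasaki g phi i) (c t) u) u e =
    bil (g i (x t)) (derive1 (derive1 x) t) (lsubmx e)
      + bil ('d (g i) (x t) (derive1 x t)) (derive1 x t) (lsubmx e).
  apply: is_derive_near_eq (is_derive_momentum e Gd ct c'd)
    (is_derive_momentum (lsubmx e) (gd : differentiable (g i) (x t)) xd x'd).
  apply: filterS2 cH x'E => s vs xs.
  by rewrite bil_phi_sasaki vs bil0l addr0 xs.
(* Along the line the fibre term is quadratic in the vertical part of the fixed [u], which vanishes
   at [r = 0]; so does its derivative there. *)
have kinetic : bil ('d (phi_sasaki g phi i) (c t) e) u u =
    bil ('d (g i) (x t) (lsubmx e)) (lsubmx u) (lsubmx u).
  pose line (r : R) := r *: e + c t.
  have l0 : line 0 = c t by rewrite /line scale0r add0r.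
  have dl := is_derive_line (c t) e 0.
  have vd : differentiable (fun y => vertical_part y u) (line 0).
    by rewrite l0; exact: differentiable_vertical_part.
  have Kd : differentiable (fiber_metric \o lsubmx) (line 0).
    rewrite l0; apply: differentiable_comp; first exact: differentiable_lsubmx.
    exact: differentiable_fiber_metric.
  have d1 := is_derive_kinetic e u Gd.
  have vl := is_derive_curve_comp dl vd.
  have d2 := is_derive_bil (is_derive_curve_comp dl Kd) vl vl.
  have d3 := is_derive_kinetic (lsubmx e) (lsubmx u) gd.
  have := is_derive_near_eq _ d1 (is_deriveD d3 d2); move=> ->; last first.
    apply: filterE => r; rewrite bil_phi_sasaki; congr (bil (g i _) _ _ + _).
    by rewrite linearD linearZ.
  by rewrite /= -/(line 0) l0 cHt !bil0l !bil0r !addr0.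
by rewrite /euler_lagrange momentum kinetic x't.
Qed.

Lemma differentiable_fiber_energy z : D (lsubmx z) ->
  differentiable fiber_energy z.
Proof.
move=> Dz; have ld := differentiable_lsubmx z.
have rd := differentiable_rsubmx z.
apply: differentiable_bil => //.
exact: (differentiable_comp ld (differentiable_fiber_metric Dz)).
Qed.

(** The Euler-Lagrange expression of [chi \o c] at [e] is that of the base curve at the base
    component of [e *m J]. These components fill the whole space because horizontal vectors are
    tangent to the hypersurface. *)
Lemma acceleration_phi_unit (S : set 'rV[R]_(n + n)) W psi O chi
    (c : R -> 'rV[R]_(n + n)) t :
  (forall z, S z -> D (lsubmx z) /\ fiber_energy z = 1) ->
  @local_parametrization R (n + n).-1 (n + n) S W psi O chi ->
  O (c t) -> (\forall s \near t, S (c s)) ->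
  (\forall s \near t, derivable c s 1) -> derivable (derive1 c) t 1 ->
  (\forall s \near t, vertical_part (c s) (derive1 c s) = 0) ->
  acceleration (pullback psi (phi_sasaki g phi i)) (chi \o c) t = 0 <->
  acceleration (g i) (fun s => lsubmx (c s)) t = 0.
Proof.
move=> SE [oW oO psis chis SO psiK] Oct Sc cd c'd cH.
have ct := nbhs_singleton cd; have [Dct Ect] := SE _ (nbhs_singleton Sc).
have [dpsi _] := psis 1; have [dchi _] := chis 1.
pose w := chi \o c; pose G := phi_sasaki g phi i.
have Oc : \forall s \near t, O (c s).
  have := differentiable_continuous ((derivable1_diffP _ _).1 ct).
  by apply; exact: open_nbhs_nbhs.
(* Near [t] the curve lies in [S] and in [O], hence in the image of [psi]. *)
have wc : \forall s \near t, W (w s) /\ c s = psi (w s).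
  apply: filterS2 Sc Oc => s Ss Os.
  have [y Wy yE] : (psi @` W) (c s) by rewrite SO.
  by rewrite /w /= -yE psiK.
have [Wt ctE] := nbhs_singleton wc.
have wE : \forall s \near t,
    is_derive (s : R) (1 : R) w (derive1 c s *m jacobian chi (c s)).
  apply: filterS2 Oc cd => s Os /is_derive1 cs.
  have := is_derive_curve_comp cs (dchi _ Os).
  move=> /is_derive_eq; apply; rewrite -deriveE ?deriveEjacobian //; exact: dchi.
have w'd : derivable (derive1 w) t 1.
  have /is_derive1 cs := ct; have /is_derive1 c's := c'd.
  have [dd _] := is_derive_mulmx c's
    (is_derive_curve_comp cs (differentiable_jacobian oO Oct (chis 2))).
  apply: near_eq_derivable dd; apply: filterS wE => s [_ <-].
  by rewrite /= derive1E.
pose J := jacobian psi (w t).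
have DJ e : 'd psi (w t) e = e *m J.
  by rewrite -deriveE ?deriveEjacobian //; exact: dpsi.
have dpsit := dpsi _ Wt.
have dchit : differentiable chi (psi (w t)) by rewrite -ctE; exact: dchi.
(* As [chi \o psi] is the identity on [W], the Jacobian of [chi] is a right inverse of [J]. *)
have Jfree : row_free J.
  apply/row_freeP; exists (jacobian chi (psi (w t))); apply/row_matrixP => k.
  rewrite !rowE mulmxA -DJ -deriveEjacobian // deriveE // mulmx1.
  have /(congr1 (fun F => F (delta_mx 0 k))) := diff_comp dpsit dchit.
  move=> /= <-; rewrite -deriveE; last exact: differentiable_comp.
  rewrite -[RHS](derive_id (w t) (delta_mx 0 k)); apply: near_eq_derive.
  by apply: (near_open oW Wt) => y Wy /=; exact: psiK.
pose V := vertical_lift (rsubmx (c t)).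
have Gs : (G (c t))^T = G (c t) := phi_sasaki_sym Dct.
(* The fibre energy is 1 on the image of [psi], so its derivative, twice the pairing with [V],
   vanishes on the vectors [e *m J]. *)
have VJ e : bil (G (c t)) V (e *m J) = 0.
  have dE := differentiable_fiber_energy Dct.
  have dE' : differentiable fiber_energy (psi (w t)) by rewrite -ctE.
  have := is_derive_unique (is_derive_diff (e *m J) dE)
    (diff_fiber_energy _ Dct).
  have /(congr1 (fun F => F e)) := diff_comp dpsit dE'.
  rewrite /= DJ -ctE => <-; rewrite -deriveE; last exact: differentiable_comp.
  have near1 : \forall y \near w t, (fiber_energy \o psi) y = cst 1 y.
    apply: (near_open oW Wt) => y Wy.
    have [Sy _] : (S `&` O) (psi y) by rewrite -SO; exists y.
    by rewrite /= (SE _ Sy).2.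
  rewrite (near_eq_derive _ near1) derive_cst => /esym/eqP.
  by rewrite mulf_eq0 pnatr_eq0 /= => /eqP.
have VV : bil (G (c t)) V V = 1.
  rewrite bil_phi_sasaki vertical_part_vertical_lift row_mxKl bil0l add0r.
  exact: Ect.
have [kU onto] :=
  hypersurface_nondegenerate (phi_sasaki_unit Dct) Gs Jfree VJ VV.
have kU' : pullback psi G (w t) \in unitmx by rewrite /pullback -ctE.
have el e : euler_lagrange (pullback psi G) w t e =
    euler_lagrange (g i) (fun s => lsubmx (c s)) t (lsubmx (e *m J)).
  rewrite -(euler_lagrange_phi_sasaki (e *m J) cd c'd Dct cH).
  apply: (euler_lagrange_pullback _ oW (psis 2)) => //.
    by apply: filterS2 wc wE => s [Ws cs] [].
  exact: differentiable_phi_sasaki.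
split=> [/(acceleration_eq0P kU') el0|].
  apply/(acceleration_eq0P (g_unit Dct)) => X.
  (* The horizontal lift of [X] is orthogonal to the vertical [V], hence tangent, and its base
     component is [X]. *)
  have [|e eE] := onto (horizontal_lift g i (c t) X).
    rewrite bil_phi_sasaki vertical_part_vertical_lift row_mxKl bil0l add0r.
    by rewrite /vertical_part row_mxKl row_mxKr addNr bil0r.
  by rewrite -(el0 e) el -eE row_mxKl.
move=> /(acceleration_eq0P (g_unit Dct)) el0.
by apply/(acceleration_eq0P kU') => e; rewrite el el0.
Qed.

End PhiSasaki.

(** * Local parametrization of the phi-unit tangent bundle *)

Section UnitHypersurface.
Context {R : realType} {n : nat} (D : set 'rV[R]_n) (H : 'rV[R]_n -> 'M[R]_n).
Context (oD : open D) (H_smooth : smooth D H).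
Implicit Types (z : 'rV[R]_(n + n)).

Let E z : R := bil (H (lsubmx z)) (rsubmx z) (rsubmx z).
Let DD : set 'rV[R]_(n + n) := [set z | D (lsubmx z)].
(** [H] need not be definite: a fibre vector can be rescaled to energy 1 only where [E] is
    positive. *)
Let U1 : set 'rV[R]_(n + n) := [set z | DD z /\ 0 < E z].

Let lc : continuous (@lsubmx R 1 n n).
Proof. exact: linear_mx_continuous. Qed.

Let rc : continuous (@rsubmx R 1 n n).
Proof. exact: linear_mx_continuous. Qed.

Let oDD : open DD.
Proof. by apply: open_comp => // z _; exact: lc. Qed.

Let E_smooth : smooth DD E.
Proof.
move=> k; apply: cd_bil => //; try exact: cd_linear.
have := cd_affine_comp 0 oD lc (H_smooth k).
have -> : [set z : 'rV[R]_(n + n) | D (lsubmx z + 0)] = DD.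
  by apply/funext => z; rewrite /DD /= addr0.
by apply: cd_eq => // z _; rewrite addr0.
Qed.

Let oU1 : open U1.
Proof.
rewrite openE => z [Dz Ez].
have Ec : {for z, continuous E}.
  by apply: differentiable_continuous; exact: (E_smooth 1).1.
by apply: filterI; [exact: open_nbhs_nbhs|exact: (cvgr_gt _ Ec _ Ez)].
Qed.

Let scale (s : R) z : 'rV[R]_(n + n) := row_mx (lsubmx z) (s *: rsubmx z).

Let E_scale s z : E (scale s z) = s ^+ 2 * E z.
Proof.
rewrite /E /scale row_mxKl row_mxKr /bil linearZ -scalemxAr -!scalemxAl.
by rewrite !mxE mulrA -expr2.
Qed.

Let scale1 z : scale 1 z = z.
Proof. by rewrite /scale scale1r hsubmxK. Qed.

Let scaleM s r z : scale s (scale r z) = scale (s * r) z.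
Proof. by rewrite /scale row_mxKl row_mxKr scalerA. Qed.

(* The hypersurface is parametrized by the projection of the affine hyperplane
   of vectors whose fibre component number k is a. *)
Lemma unit_hypersurface_parametrization z0 : D (lsubmx z0) -> E z0 = 1 ->
  exists W psi O chi,
    @local_parametrization R (n + n).-1 (n + n)
      [set z | D (lsubmx z) /\ E z = 1] W psi O chi /\ O z0.
Proof.
move=> Dz0 Ez0.
have [k y0k] : exists k, rsubmx z0 0 k != 0.
  apply: contrapT => /forallNP y0; have : E z0 = 0.
    rewrite /E; suff -> : rsubmx z0 = 0 by rewrite bil0l.
    by apply/rowP => k; rewrite [RHS]mxE; apply/eqP/negP => /negP/y0.
  by rewrite Ez0 => /eqP; rewrite oner_eq0.
pose a := rsubmx z0 0 k; pose K := rshift n k.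
have rK z : z 0 K = rsubmx z 0 k by rewrite mxE.
have aa : 0 < a * a by rewrite -expr2 exprn_even_gt0.
(* [A] inserts a zero at position [K] and [B] deletes that position; adding [b] puts the value [a]
   there. *)
pose A : 'M[R]_((n + n).-1, n + n) := row' K 1%:M.
pose B : 'M[R]_(n + n, (n + n).-1) := col' K 1%:M.
pose b : 'rV[R]_(n + n) := a *: delta_mx 0 K.
have AK w l : (w *m A) 0 l = if unlift K l is Some j then w 0 j else 0.
  rewrite mxE; case: unliftP => [j|] ->.
    rewrite (bigD1 j) //= big1 ?addr0 => [|j' /negPf jj'].
      by rewrite !mxE eqxx mulr1.
    by rewrite !mxE (inj_eq lift_inj) jj' mulr0.
  by rewrite big1 // => j _; rewrite !mxE eq_sym (negPf (neq_lift _ _)) mulr0.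
have BK z j : (z *m B) 0 j = z 0 (lift K j).
  rewrite mxE (bigD1 (lift K j)) //= big1 ?addr0 => [|l /negPf lj].
    by rewrite !mxE eqxx mulr1.
  by rewrite !mxE lj mulr0.
pose aff w := w *m A + b.
have affK w : aff w 0 K = a.
  by rewrite /aff mxE AK unlift_none !mxE !eqxx mulr1 add0r.
have affB w : aff w *m B = w.
  apply/rowP => j; rewrite BK /aff mxE AK liftK !mxE.
  by rewrite eq_sym (negPf (neq_lift _ _)) andbF mulr0 addr0.
have Baff z : z 0 K = a -> aff (z *m B) = z.
  move=> zK; apply/rowP => l; rewrite /aff mxE AK !mxE.
  case: unliftP => [j|] ->; last by rewrite !eqxx mulr1 add0r.
  by rewrite BK eq_sym (negPf (neq_lift _ _)) andbF mulr0 addr0.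
have scaleK s z : scale s z 0 K = s * z 0 K by rewrite !rK row_mxKr mxE.
pose W := [set w | U1 (aff w)].
(* [psi] rescales the fibre vector to energy 1; [chi] rescales it until its entry at [K] is [a] and
   forgets that entry. The sign condition in [O] makes the factor in [chi] positive, so the positive
   square root undoes it. *)
pose psi w := scale (Num.sqrt (E (aff w)))^-1 (aff w).
pose O := [set z | DD z /\ 0 < a * z 0 K].
pose chi z := scale (a * (z 0 K)^-1) z *m B.
pose LA := mulmxr A : {linear 'rV[R]_(n + n).-1 -> 'rV[R]_(n + n)}.
pose LB := mulmxr B : {linear 'rV[R]_(n + n) -> 'rV[R]_(n + n).-1}.
have LAc : continuous LA by exact: linear_mx_continuous.
have LBc : continuous LB by exact: linear_mx_continuous.
have affc : continuous aff.
  move=> w; apply: differentiable_continuous.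
  apply: (differentiableD (linear_differentiable w LAc)).
  exact: (differentiable_cst b).
have oW : open W by apply: open_comp => // w _; exact: affc.
have oO : open O.
  rewrite openE => z [Dz zK].
  have akc : {for z, continuous (fun z : 'rV[R]_(n + n) => a * z 0 K)}.
    apply: differentiable_continuous; apply: differentiableZ.
    exact: differentiable_coord.
  by apply: filterI; [exact: open_nbhs_nbhs|exact: (cvgr_gt _ akc _ zK)].
have zKN0 z : O z -> z 0 K != 0.
  by move=> [_]; apply: contraTneq => ->; rewrite mulr0 ltxx.
have quot_gt0 z : O z -> 0 < a * (z 0 K)^-1.
  move=> Oz; have -> : a * (z 0 K)^-1 = a * z 0 K * ((z 0 K)^-1) ^+ 2.
    by field; exact: zKN0.
  by rewrite pmulr_lgt0 ?Oz.2 // exprn_even_gt0 //= invr_neq0 // zKN0.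
have lsub_scale s z : lsubmx (scale s z) = lsubmx z by rewrite row_mxKl.
exists W, psi, O, chi; split; last by split=> //=; rewrite rK.
split=> //.
- move=> l; have U1E : smooth U1 E.
    by move=> l'; apply: cd_sub (E_smooth l') => z [].
  have P_cd : continuously_differentiable l U1
      (fun z => scale (Num.sqrt (E z))^-1 z).
    apply: (cd_row_mx oU1); first exact: cd_linear.
    apply: (cd_scale oU1); last exact: cd_linear.
    by apply: cd_inv_sqrt => // z [].
  exact: (cd_affine_comp b oU1 LAc P_cd).
- move=> l; apply: (cd_linear_comp oO LBc).
  apply: (cd_row_mx oO); first exact: cd_linear.
  apply: (cd_scale oO); last exact: cd_linear.
  have cdK l' : continuously_differentiable l' O (fun z => z 0 K).
    exact: (cd_mxP _ _ oO).1 (cd_id l' O) 0 K.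
  exact: (cdM oO (cd_cst l O a) (cdV l oO zKN0 cdK)).
- apply/seteqP; split=> [z [w [Dw Ew] <-]|z [[Dz Ez] Oz]].
    have s0 : 0 < (Num.sqrt (E (aff w)))^-1 by rewrite invr_gt0 sqrtr_gt0.
    split; split.
    + by rewrite /psi lsub_scale.
    + rewrite /psi E_scale exprVn sqr_sqrtr; last exact: ltW.
      by rewrite mulVf // gt_eqF.
    + by rewrite /DD /= /psi lsub_scale.
    + by rewrite /psi scaleK affK mulrCA mulr_gt0.
  have q0 := quot_gt0 _ Oz; have zN0 := zKN0 _ Oz.
  have affchi : aff (chi z) = scale (a * (z 0 K)^-1) z.
    by apply: Baff; rewrite scaleK divfK.
  exists (chi z).
    suff : U1 (aff (chi z)) by [].
    by rewrite affchi /U1 /DD /= lsub_scale E_scale Ez mulr1 exprn_gt0.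
  rewrite /psi affchi E_scale Ez mulr1 sqrtr_sqr gtr0_norm // scaleM.
  by rewrite mulVf ?scale1 // gt_eqF.
- move=> w [Dw Ew]; rewrite /chi /psi scaleK affK scaleM.
  have s0 : (Num.sqrt (E (aff w)))^-1 != 0.
    by rewrite invr_eq0 gt_eqF // sqrtr_gt0.
  by rewrite invfM mulrCA divff // mulr1 mulVf // scale1 affB.
Qed.

End UnitHypersurface.

(** * Change of charts for tangent vectors, and the hypersurface in a chart *)

Section TangentVectors.
Context {R : realType} {n : nat} (M : manifold (R := R) n).
Implicit Types (i j k : Defs.index M) (p : M).

Lemma image_cmap i p : dom (atlas i) p -> image_of (atlas i) (cmap (atlas i) p).
Proof. by move=> ip; exists p. Qed.

Lemma transition_differentiable i j p : dom (atlas i) p -> dom (atlas j) p ->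
  differentiable (cmap (atlas j) \o cinv (atlas i)) (cmap (atlas i) p).
Proof.
by move=> ip jp; apply: (transition_smooth i j 1).1; exists p.
Qed.

Lemma transition_jacobian_id i p : dom (atlas i) p ->
  transition_jacobian i i p = 1%:M.
Proof.
move=> ip; apply/row_matrixP => k; rewrite !rowE mulmx1.
rewrite -deriveEjacobian; last exact: transition_differentiable.
rewrite -[RHS](derive_id (cmap (atlas i) p) (delta_mx 0 k)).
apply: near_eq_derive; apply: (near_open (@open_image _ _ _ i) (image_cmap ip)).
by move=> _ [q iq <-] /=; rewrite cmapK.
Qed.

(** The chain rule: by continuity of [cinv] nearby points stay in chart [j], so the transition from
    [i] to [k] agrees there with the composite through [j]. *)
Lemma transition_jacobian_trans i j k p :
  dom (atlas i) p -> dom (atlas j) p -> dom (atlas k) p ->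
  transition_jacobian i k p =
  transition_jacobian i j p *m transition_jacobian j k p.
Proof.
move=> ip jp kp; apply/row_matrixP => l; rewrite !rowE mulmxA.
have dij := transition_differentiable ip jp.
have djk := transition_differentiable jp kp.
have dik := transition_differentiable ip kp.
pose f := cmap (atlas j) \o cinv (atlas i).
pose f' := cmap (atlas k) \o cinv (atlas j).
have fp : f (cmap (atlas i) p) = cmap (atlas j) p by rewrite /f /= cmapK.
have djk' : differentiable f' (f (cmap (atlas i) p)) by rewrite fp.
set x := cmap (atlas i) p; set e := delta_mx 0 l.
have compE : 'D_e (f' \o f) x = 'd f' (f x) ('d f x e).
  rewrite deriveE; last exact: differentiable_comp.
  by have /(congr1 (fun F => F e)) := diff_comp dij djk'.
have JE (h : 'rV[R]_n -> 'rV[R]_n) y v : differentiable h y ->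
    'd h y v = v *m jacobian h y.
  by move=> dh; exact: etrans (esym (deriveE _ dh)) (deriveEjacobian _ dh).
rewrite [LHS](esym (deriveEjacobian e dik)).
refine (etrans (etrans _ compE) _).
  apply: near_eq_derive.
  have ci : {for x, continuous (cinv (atlas i))}.
    exact/cinv_continuous/image_cmap.
  have nj : \forall y \near x, dom (atlas j) (cinv (atlas i) y).
    apply: ci; rewrite cmapK //.
    exact: open_nbhs_nbhs (conj (@open_dom _ _ M j) jp).
  by apply: filterS nj => y jy; rewrite /f' /f /= cmapK.
refine (etrans (JE _ _ _ djk') _); rewrite fp; congr (_ *m _); exact: JE dij.
Qed.

(** The other components are transported from chart [i] by Jacobians, and the cocycle rule makes
    them compatible. *)
Lemma exists_tangent i p (y : 'rV[R]_n) : dom (atlas i) p ->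
  exists v : tangent p, component v i = y.
Proof.
(* The value 0 for charts not containing [p] is the one that [component_out] imposes. *)
move=> ip; pose comp j := if pselect (dom (atlas j) p)
  then y *m transition_jacobian i j p else 0.
have compE j : dom (atlas j) p -> comp j = y *m transition_jacobian i j p.
  by rewrite /comp; case: pselect.
have comp_trans j k : dom (atlas j) p -> dom (atlas k) p ->
    comp k = comp j *m transition_jacobian j k p.
  move=> jp kp; rewrite (compE _ jp) (compE _ kp).
  by rewrite (transition_jacobian_trans ip jp kp) mulmxA.
have comp_out j : ~ dom (atlas j) p -> comp j = 0.
  by rewrite /comp; case: pselect.
exists (Tangent comp_trans comp_out).
by rewrite /= (compE _ ip) (transition_jacobian_id ip) mulmx1.
Qed.

(** Membership asks for the equation in every chart, but the transformation laws of [g] and [phi]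
    make it independent of the chart. Every coordinate vector is realized by [exists_tangent]. *)
Lemma image_phi_unit_tangent_bundle (phi g : tensor2 M) i :
  is_covariant2 g -> is_endomorphism phi ->
  tangent_coord i @` (tangent_dom i `&` phi_unit_tangent_bundle g phi) =
  [set z | image_of (atlas i) (lsubmx z) /\ fiber_energy phi g i z = 1].
Proof.
move=> [_ gT] [_ phiT]; apply/seteqP; split.
  move=> _ [[p v] [/= ip Tv] <-]; rewrite /fiber_energy row_mxKl row_mxKr.
  by rewrite bil_fiber_metric; split; [exact: image_cmap|exact: Tv].
move=> z [[p ip pz] Ez]; have [v vz] := exists_tangent (rsubmx z) ip.
exists (existT _ p v); last by rewrite /tangent_coord /= vz pz hsubmxK.
split=> // j jp /=; rewrite (component_transition v ip jp) vz.
move: Ez; rewrite /fiber_energy bil_fiber_metric -pz (gT i j) // => <-.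
rewrite /bil !trmx_mul !mulmxA; congr ((_ *m _) 0 0).
rewrite -!mulmxA; do 3 congr (_ *m _).
by rewrite -[in RHS]trmx_mul phiT // trmx_mul.
Qed.

End TangentVectors.

(** * From a single chart to the equivalence for curves on the manifold *)

Theorem corollary4p4 (R : realType) (m : nat) (M : manifold (R := R) (2 * m))
    (phi g : tensor2 M) (J : set R) (gamma : R -> M)
    (xi : forall t : R, tangent (gamma t)) :
  para_kahler_norden phi g ->
  open J -> is_interval J ->
  smooth_field_along J xi ->
  (forall t : R, J t -> phi_unit_tangent_bundle g phi (lift_curve xi t)) ->
  is_horizontal_lift g J xi ->
  is_geodesic_phi_unit phi g J (lift_curve xi) <-> is_geodesic g J gamma.
Proof.
move=> [[gcov gsym gpos] phiend phiinv _ _ _ phisym phipar] oJ _.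
move=> [gammac cs] T1 hor.
have gs i := gcov.1 i; have phis i := phiend.1 i.
pose c i := tangent_coord i \o lift_curve xi.
pose S i :=
  tangent_coord i @` (tangent_dom i `&` phi_unit_tangent_bundle g phi).
have SE i := image_phi_unit_tangent_bundle i gcov phiend.
have xE i : cmap (atlas i) \o gamma = (fun s => lsubmx (c i s)).
  by apply/funext => s; rewrite /c /tangent_coord /= row_mxKl.
(* For each chart and each parametrization the two accelerations vanish together; only the
   quantifiers remain after this. *)
have key t i (W : set 'rV[R]_(2 * m + 2 * m).-1) psi O chi :
    J t -> dom (atlas i) (gamma t) ->
    local_parametrization (S i) W psi O chi -> O (c i t) ->
    acceleration (pullback psi (phi_sasaki g phi i)) (chi \o c i) t = 0 <->
    acceleration (g i) (cmap (atlas i) \o gamma) t = 0.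
  move=> Jt it par Oct.
  (* The times spent in chart [i], a neighbourhood of each of its points by continuity of [gamma];
     the local lemma needs its hypotheses near [t]. *)
  pose T : set R := J `&` [set s | dom (atlas i) (gamma s)].
  have nearT s : T s -> \forall r \near s, T r.
    move=> [Js js]; apply: filterI; first exact: open_nbhs_nbhs.
    apply: (gammac s Js).
    exact: open_nbhs_nbhs (conj (@open_dom _ _ M i) js).
  have Tt : T t by [].
  have cd s : T s -> derivable (c i) s 1.
    by move=> Ts; apply: diff_derivable; exact: (cs i 1).1.
  have SE' z : S i z ->
      image_of (atlas i) (lsubmx z) /\ fiber_energy phi g i z = 1.
    by rewrite /S SE.
  rewrite xE; have := acceleration_phi_unit (gs i) (phis i) (@gsym i) (@gpos i)
    (@phiinv i) (@phisym i) (@phipar i) SE' par Oct.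
  apply.
  - apply: filterS (nearT t Tt) => s [Js js].
    by exists (lift_curve xi s) => //; split=> //; exact: T1.
  - by apply: filterS (nearT t Tt) => s; exact: cd.
  - have -> : derive1 (c i) = 'D_1 (c i) by apply/funext => s; rewrite derive1E.
    by apply: diff_derivable; exact: ((cs i 2).2 1).1.
  (* In coordinates, horizontality says that the vertical part of the velocity vanishes. *)
  - apply: filterS (nearT t Tt) => s Ts.
    have := hor s i Ts.1 Ts.2; rewrite /covariant_along /vertical_part.
    have /is_derive1 ds := cd s Ts.
    have dl := is_derive_curve_comp ds (differentiable_lsubmx (c i s)).
    have dr := is_derive_curve_comp ds (differentiable_rsubmx (c i s)).
    rewrite diff_lsubmx in dl; rewrite diff_rsubmx in dr.
    have yE : (fun s => component (xi s) i) = rsubmx \o c i.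
      by apply/funext => r; rewrite /c /tangent_coord /= row_mxKr.
    have xE' : cmap (atlas i) \o gamma = lsubmx \o c i by rewrite xE.
    rewrite yE xE' (derive1E (rsubmx \o c i)) (derive1E (lsubmx \o c i)).
    rewrite (derive_val (is_derive := dl)).
    rewrite (derive_val (is_derive := dr)).
    by have -> : component (xi s) i = rsubmx (c i s) by rewrite /c /= row_mxKr.
(* A geodesic of the hypersurface is tested in all parametrizations, so the first direction must
   exhibit one around the given point; in the second direction it is given. *)
split=> [geo t i Jt it|geo T t i Jt it W psi O chi par Oct].
  have [Dct Ect] : [set z | image_of (atlas i) (lsubmx z) /\
      fiber_energy phi g i z = 1] (c i t).
    by rewrite -SE; exists (lift_curve xi t) => //; split=> //; exact: T1.
  have H_smooth : smooth (image_of (atlas i)) (fiber_metric phi g i).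
    move=> k; apply: (cd_mulmx (@open_image _ _ M i)); first exact: gs.
    by apply: (cd_trmx (@open_image _ _ M i)); exact: phis.
  have [W [psi [U [chi [par Uct]]]]] :=
    unit_hypersurface_parametrization (@open_image _ _ M i) H_smooth Dct Ect.
  rewrite -SE in par.
  exact: (key t i _ _ _ _ Jt it par Uct).1 (geo t i Jt it _ _ _ _ par Uct).
exact: (key t i _ _ _ _ Jt it par Oct).2 (geo t i Jt it).
Qed.
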